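(* Let $n\ge 2$ and let $(M,g)$ be an $n$-dimensional complete Riemannian manifold (without boundary) such that the local Moser-Trudinger inequality (LMT) holds on $M$. Then, for any open set $\Omega\subseteq M$, the following two statements are equivalent: (CMT) there is a constant $C_\Omega>0$ such that $$\int_\Omega \exp_{n-2}\big[\gamma_n|u|^{\frac{n}{n-1}}\big]\,d\mu\le C_\Omega\qquad\text{for all } u\in W_0^{1,n}(\Omega)\text{ with } \|\nabla u\|_n\le 1;$$ (Pn) there is a constant $C_\Omega>0$ such that $$\|u\|_n\le C_\Omega\|\nabla u\|_n\qquad\text{for all } u\in W_0^{1,n}(\Omega).$$ (The constants in the two statements need not be the same.)
   Context: $\mu$ is the Riemannian measure of $(M,g)$; $\nabla u$ is the Riemannian gradient, $|\nabla u|^2=g(\nabla u,\nabla u)$, and $\|\cdot\|_n$ is the $L^n$ norm with respect to $\mu$. $W^{1,n}(M)$ is the usual Sobolev space, which on a complete manifold coincides with $W^{1,n}_0(M)$, and $W_0^{1,n}(\Omega)$ is the closure of $C_c^\infty(\Omega)$ in $W^{1,n}$. The constant is $\gamma_n=n\,\omega_{n-1}^{\frac{1}{n-1}}$, where $\omega_{n-1}$ is the surface measure of the standard unit sphere $S^{n-1}\subset\mathbb{R}^n$. For an integer $m\ge 0$, $\exp_m[t]=e^t-\sum_{k=0}^m \frac{t^k}{k!}$. (LMT): the local Moser-Trudinger inequality holds on $M$ (or on $W^{1,n}(M)$) if there are constants $\tau,C_0>0$ such that for every bounded measurable set $E\subseteq M$ with $\mu(E)\le\tau$, $$\int_E e^{\gamma_n|u|^{\frac{n}{n-1}}}\,d\mu\le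 C_0\qquad\text{for all } u\in W^{1,n}(M)\text{ with } \|\nabla u\|_n\le 1,\ \operatorname{supp}u\subseteq E,$$ where $\operatorname{supp}u$ is the essential support, i.e. $\operatorname{supp}u\subseteq E$ means $u=0$ a.e. on $M\setminus E$. *)

(* Defs.v *)
From HB Require Import structures.
From mathcomp Require Import all_boot all_order all_algebra.
From mathcomp Require Import all_classical all_reals all_analysis.

Set Implicit Arguments.
Unset Strict Implicit.
Unset Printing Implicit Defensive.

Import Order.TTheory GRing.Theory Num.Theory.
Import numFieldNormedType.Exports.

Local Open Scope classical_set_scope.
Local Open Scope ring_scope.

(** ** Lebesgue measure on R^n *)

Section lebesgue_step.
Local Open Scope ereal_scope.
Context {R : realType} {n : nat}.
Local Notation RR := (measurableTypeR R).
Variable m : {sigma_finite_measure set (n.-tuple RR) -> \bar R}.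

Definition tcons (p : RR * n.-tuple RR) : n.+1.-tuple RR :=
  [tuple of p.1 :: p.2].

Definition tuncons (t : n.+1.-tuple RR) : RR * n.-tuple RR :=
  (thead t, [tuple of behead t]).

Lemma measurable_tcons : measurable_fun setT tcons.
Proof. exact: (measurable_cons measurable_fst measurable_snd). Qed.

Lemma measurable_tuncons : measurable_fun setT tuncons.
Proof.
apply: measurable_fun_pair; first exact: measurable_tnth.
exact: measurable_behead.
Qed.

Lemma tconsK : cancel tcons tuncons.
Proof.
by move=> [x t]; rewrite /tuncons/=; congr pair; exact: val_inj.
Qed.

Lemma tunconsK : cancel tuncons tcons.
Proof. by move=> t; rewrite [RHS]tuple_eta. Qed.

Definition lebesgue_step (A : set (n.+1.-tuple RR)) : \bar R :=
  (lebesgue_measure \x m) (tcons @^-1` A).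

Let measurable_pre A : measurable A -> measurable (tcons @^-1` A).
Proof. by move=> mA; rewrite -[X in measurable X]setTI; exact: measurable_tcons. Qed.

Let lebesgue_step0 : lebesgue_step set0 = 0.
Proof. by rewrite /lebesgue_step preimage_set0 measure0. Qed.

Let lebesgue_step_ge0 A : 0 <= lebesgue_step A.
Proof. exact: measure_ge0. Qed.

Let lebesgue_step_sigma_additive : semi_sigma_additive lebesgue_step.
Proof.
move=> F mF tF mUF; rewrite /lebesgue_step preimage_bigcup.
apply: measure_semi_sigma_additive.
- by move=> k; exact: measurable_pre.
- apply/trivIsetP => /= i j _ _ ij; rewrite -preimage_setI.
  by move/trivIsetP : tF => /(_ _ _ _ _ ij) ->//; rewrite preimage_set0.
- by rewrite -preimage_bigcup; exact: measurable_pre.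
Qed.

HB.instance Definition _ := isMeasure.Build _ _ _ lebesgue_step
  lebesgue_step0 lebesgue_step_ge0 lebesgue_step_sigma_additive.

Let lebesgue_step_sigma_finite : sigma_finite setT lebesgue_step.
Proof.
have /sigma_finiteP[F [FT ndF Foo]] := sigma_finiteT (@lebesgue_measure R).
have /sigma_finiteP[G [GT ndG Goo]] := sigma_finiteT m.
exists (fun k => tuncons @^-1` (F k `*` G k)).
  rewrite -preimage_bigcup (_ : \bigcup_k _ = setT) ?preimage_setT//.
  rewrite -subTset => -[x y] _.
  have [i _ Fix] : (\bigcup_k F k) x by rewrite -FT.
  have [j _ Gjy] : (\bigcup_k G k) y by rewrite -GT.
  exists (maxn i j) => //; split => /=.
  - by move: x Fix; exact/subsetPset/ndF/leq_maxl.
  - by move: y Gjy; exact/subsetPset/ndG/leq_maxr.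
move=> k; have [mF Fk] := Foo k; have [mG Gk] := Goo k; split.
  by rewrite -[X in measurable X]setTI; apply: measurable_tuncons => //;
    exact: measurableX.
rewrite /lebesgue_step -comp_preimage (_ : tuncons \o tcons = id); last first.
  by apply/funext; exact: tconsK.
rewrite preimage_id.
by rewrite product_measure1E// lte_mul_pinfty// ge0_fin_numE.
Qed.

HB.instance Definition _ := Measure_isSigmaFinite.Build _ _ _ lebesgue_step
  lebesgue_step_sigma_finite.

End lebesgue_step.

Fixpoint lebesgue_tuple (R : realType) (n : nat) :
    {sigma_finite_measure set (n.-tuple (measurableTypeR R)) -> \bar R} :=
  match n with
  | 0 => \d_([tuple])
  | n'.+1 => lebesgue_step (lebesgue_tuple R n')
  end.

Section euclidean.
Context {R : realType} {n : nat}.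

Definition row_of_tuple (t : n.-tuple (measurableTypeR R)) : 'rV[R]_n :=
  \row_i tnth t i.

Definition sqnorm2 (x : 'rV[R]_n) : R := \sum_(i < n) x ord0 i ^+ 2.

Definition unit_sphere : set 'rV[R]_n := [set x | sqnorm2 x = 1].

Definition cone (A : set 'rV[R]_n) : set 'rV[R]_n :=
  [set y | exists r x, [/\ 0 < r <= 1, A x & y = r *: x]].

(* Surface measure of a subset A of the unit sphere of R^n, defined through
   polar coordinates as n times the volume of the cone over A. *)
Definition sphere_measure (A : set 'rV[R]_n) : \bar R :=
  (n%:R%:E * lebesgue_tuple R n (row_of_tuple @^-1` cone A))%E.

End euclidean.

(* omega R n is the surface measure of S^(n-1), written omega_(n-1). *)
Definition omega (R : realType) (n : nat) : R :=
  fine (sphere_measure (@unit_sphere R n)).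

Definition gamma_mt (R : realType) (n : nat) : R :=
  n%:R * omega R n `^ (n.-1%:R)^-1.

Definition exp_trunc {R : realType} (m : nat) (t : R) : R :=
  expR t - \sum_(0 <= k < m.+1) t ^+ k / k`!%:R.

(** ** Smooth maps on open subsets of R^n *)

Section smooth.
Context {R : realType} {n : nat} {W : normedModType R}.

Fixpoint Ck (k : nat) (U : set 'rV[R]_n) (f : 'rV[R]_n -> W) : Prop :=
  match k with
  | 0 => forall x, U x -> {for x, continuous f}
  | k'.+1 => (forall x, U x -> differentiable f x) /\
             forall i : 'I_n, Ck k' U (fun x => 'D_(delta_mx ord0 i) f x)
  end.

Definition smooth_on (U : set 'rV[R]_n) (f : 'rV[R]_n -> W) : Prop :=
  forall k, Ck k U f.

End smooth.

(** ** Riemannian manifolds *)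

Record chart (R : realType) (n : nat) (M : topologicalType) := Chart {
  chart_dom : set M ;
  chart_map : M -> 'rV[R]_n ;
  chart_inv : 'rV[R]_n -> M ;
  chart_dom_open : open chart_dom ;
  chart_img_open : open (chart_map @` chart_dom) ;
  chart_mapK : forall p, chart_dom p -> chart_inv (chart_map p) = p ;
  chart_map_cont : forall p, chart_dom p -> {for p, continuous chart_map} ;
  chart_inv_cont : forall x, (chart_map @` chart_dom) x ->
    {for x, continuous chart_inv}
}.

Definition chart_img (R : realType) n (M : topologicalType) (c : chart R n M) :
  set 'rV[R]_n := chart_map c @` chart_dom c.

Definition transition (R : realType) n (M : topologicalType)
  (c c' : chart R n M) : 'rV[R]_n -> 'rV[R]_n := chart_map c' \o chart_inv c.

(* Vectors are rows and 'd f x v = v *m 'J f x, so a tangent vector with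
   components v in the chart i has components v *m 'J (transition i j) in the
   chart j. The metric is given by its Gram matrices [gram i] in the charts. *)
Record riemannianManifold (R : realType) (n : nat) := RiemannianManifold {
  carrier :> ptopologicalType ;
  rm_hausdorff : hausdorff_space carrier ;
  rm_second_countable : @second_countable carrier ;
  chart_index : Type ;
  atlas : chart_index -> chart R n carrier ;
  chart_at : carrier -> chart_index ;
  chart_atP : forall p, chart_dom (atlas (chart_at p)) p ;
  atlas_smooth : forall i j, smooth_on
    (chart_map (atlas i) @` (chart_dom (atlas i) `&` chart_dom (atlas j)))
    (transition (atlas i) (atlas j)) ;
  gram : chart_index -> 'rV[R]_n -> 'M[R]_n ;
  gram_smooth : forall i, smooth_on (chart_img (atlas i)) (gram i) ;
  gram_sym : forall i x, chart_img (atlas i) x -> (gram i x)^T = gram i x ;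
  gram_pos : forall i x, chart_img (atlas i) x -> forall v : 'rV[R]_n,
    v != 0 -> 0 < (v *m gram i x *m v^T) ord0 ord0 ;
  gram_change : forall i j p,
    chart_dom (atlas i) p -> chart_dom (atlas j) p ->
    let x := chart_map (atlas i) p in
    let J := 'J (transition (atlas i) (atlas j)) x in
    gram i x = J *m gram j (chart_map (atlas j) p) *m J^T
}.

Section riemannian.
Context {R : realType} {n : nat} (M : riemannianManifold R n).
Implicit Types (i j : chart_index M) (p q : M).

(** *** Riemannian distance, completeness, bounded sets *)

(* In some chart i, the path c on [0, 1] represents a C^1 curve from p to q of
   length l; asking c to be C^1 on all of R is harmless, since a C^1 path on
   [0, 1] extends affinely. *)
Definition C1_piece p q (l : \bar R) : Prop :=
  exists i (c : R -> 'rV[R]_n),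
    [/\ (forall t, derivable c t 1) /\ continuous (derive1 c),
        forall t, 0 <= t <= 1 -> chart_img (atlas i) (c t),
        chart_inv (atlas i) (c 0) = p, chart_inv (atlas i) (c 1) = q &
        l = (\int[lebesgue_measure]_(t in `[0%R, 1%R]) (Num.sqrt
              ((derive1 c t *m gram i (c t) *m (derive1 c t)^T) ord0 ord0))%:E)%E].

(* A piecewise C^1 curve can be subdivided so that each piece is C^1 and stays
   in a chart domain. *)
Inductive curve_length : M -> M -> \bar R -> Prop :=
| curve_nil p : curve_length p p 0%E
| curve_cons p q r (l l' : \bar R) : C1_piece p q l -> curve_length q r l' ->
    curve_length p r (l + l')%E.

(* +oo when p and q are in different connected components. *)
Definition rdist p q : \bar R := ereal_inf [set l | curve_length p q l].

Definition rcomplete : Prop :=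
  forall x : nat -> M,
    (forall e : R, 0 < e -> exists N : nat, forall k m, (N <= k)%N -> (N <= m)%N ->
       (rdist (x k) (x m) < e%:E)%E) ->
    exists p, x @ \oo --> p.

(* Several balls are only needed when M is not connected: on a connected M a
   finite union of balls is contained in one ball. *)
Definition rbounded (E : set M) : Prop :=
  exists (s : seq M) (r : R),
    forall q, E q -> exists2 p, p \in s & (rdist p q < r%:E)%E.

(** *** Riemannian measure *)

Definition borel : Type := g_sigma_algebraType (@open M).
HB.instance Definition _ := Measurable.on borel.

(* In every chart, mu has density sqrt (det g) with respect to the Lebesgue
   measure; this determines mu since countably many charts cover M. *)
Definition riemannian_measure (mu : {measure set borel -> \bar R}) : Prop :=
  forall i (E : set borel), measurable E -> E `<=` chart_dom (atlas i) ->
    mu E = (\int[lebesgue_tuple R n]_(t in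
              row_of_tuple @^-1` (chart_map (atlas i) @` E))
              (Num.sqrt (\det (gram i (row_of_tuple t))))%:E)%E.

(** *** Smooth functions, vector fields, gradient *)

Definition smooth (u : M -> R) : Prop :=
  forall i, smooth_on (chart_img (atlas i)) (u \o chart_inv (atlas i) : _ -> R).

(* A vector field X gives at each p the components of a tangent vector in the
   preferred chart [chart_at p]. *)
Definition vfield : Type := M -> 'rV[R]_n.

Definition pchart p : chart R n M := atlas (chart_at p).

Definition vnorm (X : vfield) p : R :=
  Num.sqrt ((X p *m gram (chart_at p) (chart_map (pchart p) p) *m (X p)^T)
              ord0 ord0).

Definition vcomp (X : vfield) i p : 'rV[R]_n :=
  X p *m 'J (transition (pchart p) (atlas i)) (chart_map (pchart p) p).

Definition measurable_vfield (X : vfield) : Prop :=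
  forall i (k : 'I_n), measurable_fun (chart_dom (atlas i) : set borel)
    (fun p : borel => vcomp X i p ord0 k).

(* In coordinates (grad u)^k = sum_l (d_l u) g^(lk). *)
Definition grad (u : M -> R) : vfield := fun p =>
  let x := chart_map (pchart p) p in
  (\row_k 'D_(delta_mx ord0 k) (u \o chart_inv (pchart p) : _ -> R) x)
    *m invmx (gram (chart_at p) x).

(** *** Sobolev spaces *)

Section sobolev.
Variable mu : {measure set borel -> \bar R}.

Definition norm_n (u : M -> R) : \bar R :=
  Lnorm mu n%:R%:E (fun p : borel => (u p)%:E).

Definition sobolev_cvg (phi : nat -> M -> R) (u : M -> R) (X : vfield) : Prop :=
  norm_n (fun p => phi k p - u p) @[k --> \oo] --> 0%E /\
  norm_n (vnorm (fun p => grad (phi k) p - X p)) @[k --> \oo] --> 0%E.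

(* [W1n u X] : u belongs to W^(1,n)(M) and X is its gradient. The space is the
   completion of the smooth functions of finite W^(1,n) norm, its elements
   being represented by Borel functions. *)
Definition W1n (u : M -> R) (X : vfield) : Prop :=
  [/\ measurable_fun setT (u : borel -> R), measurable_vfield X &
      exists phi : nat -> M -> R,
        (forall k, [/\ smooth (phi k), (norm_n (phi k) < +oo)%E &
                       (norm_n (vnorm (grad (phi k))) < +oo)%E]) /\
        sobolev_cvg phi u X].

Definition test_function (Omega : set M) (phi : M -> R) : Prop :=
  let supp := closure [set p | phi p != 0] in
  [/\ smooth phi, compact supp & supp `<=` Omega].

Definition W1n0 (Omega : set M) (u : M -> R) (X : vfield) : Prop :=
  W1n u X /\ exists phi : nat -> M -> R,
    (forall k, test_function Omega (phi k)) /\ sobolev_cvg phi u X.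

(** *** The inequalities *)

Definition mt_arg (t : R) : R :=
  gamma_mt R n * `|t| `^ (n%:R / n.-1%:R).

Definition local_moser_trudinger : Prop :=
  exists tau C0 : R, [/\ 0 < tau, 0 < C0 &
    forall E : set borel, measurable E -> rbounded E -> (mu E <= tau%:E)%E ->
    forall u X, W1n u X -> (norm_n (vnorm X) <= 1)%E ->
      {ae mu, forall p, ~ E p -> u p = 0} ->
      (\int[mu]_(p in E) (expR (mt_arg (u p)))%:E <= C0%:E)%E].

Definition moser_trudinger (Omega : set M) : Prop :=
  exists2 C : R, 0 < C &
    forall u X, W1n0 Omega u X -> (norm_n (vnorm X) <= 1)%E ->
      (\int[mu]_(p in (Omega : set borel))
         (exp_trunc (n - 2) (mt_arg (u p)))%:E <= C%:E)%E.

Definition poincare (Omega : set M) : Prop :=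
  exists2 C : R, 0 < C &
    forall u X, W1n0 Omega u X ->
      (norm_n u <= C%:E * norm_n (vnorm X))%E.

End sobolev.

End riemannian.

(* Main.v *)
Require Import Defs.
From mathcomp Require Import all_boot all_order all_algebra.
From mathcomp Require Import all_classical all_reals all_analysis.
From mathcomp Require Import measurable_realfun ring lra.

(** From Moser-Trudinger to Poincare. The first term of the truncated
    exponential series is [t ^+ n.-1 / n.-1`!], and with
    [t = gamma_mt R n * `|u| `^ (n / (n - 1))] it is a positive multiple of
    [`|u| ^+ n]. Applying the Moser-Trudinger inequality to [u / t] for all [t]
    above the norm of the gradient of [u] therefore bounds the norm of [u] over
    [Omega], and [u] vanishes almost everywhere outside [Omega]
    ([W1n0_ae0], [poincare_of_moser_trudinger]).

    From Poincare to Moser-Trudinger. A function is small enough to be treated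
    by the Poincare inequality below some level [s], and the set where it
    exceeds [s] is small enough for the local inequality. The difficulty is that
    the constant [gamma_mt] is critical: replacing [`|u|] by its excess over a
    fixed level multiplies the exponent by a factor larger than 1, which the
    local inequality does not tolerate. The remedy is a level that depends on
    the function. For a test function [phi] whose gradient has norm at most 1,
    let [s] be such that [`|phi|] exceeds [s] on a set of measure at most [tau]
    and exceeds [s / 2] on a set of measure more than [tau]
    ([superlevel_selection]); if there is no such [s], the local inequality
    applies to [phi] itself. Write [phi = v + w], where [v] is the excess over
    the level [s] and [w] is capped. Since [`|w|] is at least [s / 2] on a set of
    measure more than [tau], the Poincare inequality for [w] shows that the gradient of [w]
    has energy at least [2 * a], with [a] a constant multiple of [s ^+ n].
    The energies of [v] and [w] add up to at most 1 ([test_function_truncation]),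
    hence [v / (1 - a) `^ n^-1] is admissible in the local inequality.
    From [`|phi| <= `|v| + 2 * s] and Hoelder's inequality for two terms
    ([mt_arg_split]), the exponent at [phi] exceeds the exponent at
    [v / (1 - a) `^ n^-1] by at most that at [b], with
    [b ^+ n = (2 * s) ^+ n / a] independent of [phi]. This gives a uniform bound
    for test functions ([test_function_moser_trudinger]), and density with
    Fatou's lemma gives the general case ([sobolev_approximation],
    [moser_trudinger_of_poincare]).

    The functions [v] and [w] have to be Sobolev functions. The truncation is
    built from [x exp(-1/x)], whose slope lies between 0 and 1, so that it is
    smooth and [v] and [w] are again test functions: they need no approximation,
    and their gradients are given by the chain rule. The local inequality
    also requires bounded sets, hence the comparison of the Riemannian distance
    with charts ([compact_rbounded]). *)

Set Implicit Arguments.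
Unset Strict Implicit.
Unset Printing Implicit Defensive.

Import Order.TTheory GRing.Theory Num.Theory.
Import numFieldNormedType.Exports.

Local Open Scope classical_set_scope.
Local Open Scope ring_scope.

(** * Positivity of the critical constant, and the truncated exponential *)

Section gamma_positive.
Context {R : realType}.
Local Notation RR := (measurableTypeR R).

Definition tuple_cube (n : nat) (a b : R) : set (n.-tuple RR) :=
  [set t | forall i, a <= tnth t i <= b].
Arguments tuple_cube : clear implicits.

Lemma measurable_tuple_cube n a b : measurable (tuple_cube n a b).
Proof.
rewrite (_ : tuple_cube n a b =
  \bigcap_(i in [set: 'I_n]) ((fun t : n.-tuple RR => tnth t i) @^-1` `[a, b])).
  apply: fin_bigcap_measurable => [|i _]; first exact: finite_finset.
  rewrite -[X in measurable X]setTI.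
  by apply: measurable_tnth => //; exact: measurable_itv.
apply/seteqP; split => t /= h i => [_|].
  by rewrite /= in_itv /=; exact: h.
by have := h i I; rewrite /= in_itv.
Qed.

Lemma lebesgue_tuple_cube n (a b : R) : a < b ->
  lebesgue_tuple R n (tuple_cube n a b) = ((b - a) ^+ n)%:E.
Proof.
move=> ab; elim: n => [|n IH].
  rewrite /= diracE expr0 mem_set //=.
  by move=> i; case: i.
rewrite /= /lebesgue_step.
have -> : @tcons R n @^-1` tuple_cube n.+1 a b = `[a, b]%classic `*` tuple_cube n a b.
  apply/seteqP; split => -[x t] /=.
    move=> h; split; first by have := h ord0; rewrite /= tnth0 in_itv.
    by move=> i; have := h (lift ord0 i); rewrite tnthS.
  move=> [+ h] i; rewrite in_itv /= => hx.
  by case: (unliftP ord0 i) => [j ->|->]; rewrite ?tnthS ?tnth0//; exact: h.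
rewrite product_measure1E//; last exact: measurable_tuple_cube.
rewrite IH; transitivity ((b - a)%:E * ((b - a) ^+ n)%:E)%E; last by rewrite -EFinM exprS.
congr (_ * _)%E.
by have := @lebesgue_measure_itv R `[a, b]; rewrite /= lte_fin ab EFinB.
Qed.

Lemma sqnorm2_row_of_tuple n (t : n.-tuple RR) :
  sqnorm2 (row_of_tuple t) = \sum_(i < n) (tnth t i : R) ^+ 2.
Proof. by apply: eq_bigr => i _; rewrite mxE. Qed.

Lemma cone_unit_sphere n :
  cone (@unit_sphere R n) = [set x | 0 < sqnorm2 x <= 1].
Proof.
have sqZ r (x : 'rV[R]_n) : sqnorm2 (r *: x) = r ^+ 2 * sqnorm2 x.
  by rewrite /sqnorm2 mulr_sumr; apply: eq_bigr => i _; rewrite mxE exprMn.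
apply/seteqP; split => x /=.
  move=> [r [y [/andP[r0 r1] sy ->]]].
  rewrite sqZ; move: sy; rewrite /unit_sphere /= => ->.
  by rewrite mulr1 exprn_gt0//= exprn_ile1// ltW.
move=> /andP[x0 x1]; exists (Num.sqrt (sqnorm2 x)), ((Num.sqrt (sqnorm2 x))^-1 *: x).
have s0 : 0 < Num.sqrt (sqnorm2 x) by rewrite sqrtr_gt0.
split.
- by rewrite s0 -[leRHS]sqrtr1 ler_wsqrtr.
- by rewrite /unit_sphere /= sqZ exprVn sqr_sqrtr ?(ltW x0)// mulVf ?gt_eqF.
- by rewrite scalerA divff ?scale1r// gt_eqF.
Qed.

Lemma measurable_sphere_cone n :
  measurable (@row_of_tuple R n @^-1` cone (@unit_sphere R n)).
Proof.
rewrite cone_unit_sphere.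
rewrite (_ : _ @^-1` _ =
  (fun t : n.-tuple RR => \sum_(i < n) tnth t i ^+ 2) @^-1` `]0, 1]).
  rewrite -[X in measurable X]setTI.
  have mf : measurable_fun [set: n.-tuple RR] (fun t : n.-tuple RR => \sum_(i < n) (tnth t i : R) ^+ 2).
    apply: measurable_sum => i; exact: (measurable_funX 2 (measurable_tnth i)).
  exact: mf.
apply/seteqP; split => t /=; by rewrite in_itv /= sqnorm2_row_of_tuple.
Qed.

(** The punctured unit ball, whose volume defines the surface measure, lies
between two cubes. The upper cube matters as much as the lower one: [fine]
sends an infinite volume to [0]. *)
Lemma omega_gt0 n : (0 < n)%N -> 0 < omega R n.
Proof.
move=> n0; rewrite /omega /sphere_measure.
have nR0 : 0 < n%:R :> R by rewrite ltr0n.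
set A := _ @^-1` _.
have mA : measurable A by exact: measurable_sphere_cone.
have AE : A = [set t : n.-tuple RR | 0 < \sum_(i < n) (tnth t i : R) ^+ 2 <= 1].
  rewrite /A cone_unit_sphere; apply/seteqP; split => t /=;
  by rewrite sqnorm2_row_of_tuple.
have lo : (((n%:R^-1 - (2 * n%:R)^-1) ^+ n)%:E <= lebesgue_tuple R n A)%E.
  rewrite -lebesgue_tuple_cube; last first.
    by rewrite ltf_pV2 ?posrE ?mulr_gt0// ltr_pMl// ltr1n.
  apply: le_measure; rewrite ?inE//; first exact: measurable_tuple_cube.
  rewrite AE => t /= h; apply/andP; split.
    apply: (@lt_le_trans _ _ (\sum_(i < n) (2 * n%:R)^-1 ^+ 2)).
      rewrite sumr_const card_ord pmulrn_rgt0 ?n0// exprn_gt0// invr_gt0 mulr_gt0//.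
    apply: ler_sum => i _; have /andP[h1 h2] := h i.
    by rewrite lerXn2r ?nnegrE// (le_trans _ h1)// invr_ge0 mulr_ge0// ltW.
  apply: (@le_trans _ _ (\sum_(i < n) n%:R^-1)); last first.
    by rewrite sumr_const card_ord -(mulr_natr n%:R^-1) mulVf// gt_eqF.
  apply: ler_sum => i _; have /andP[h1 h2] := h i.
  have t0 : 0 <= tnth t i by rewrite (le_trans _ h1)// invr_ge0 mulr_ge0// ltW.
  rewrite expr2 (le_trans _ h2)// ler_piMr// (le_trans h2)//.
  by rewrite invf_le1// ler1n.
have hi : (lebesgue_tuple R n A <= ((1 - (-1)) ^+ n)%:E)%E.
  rewrite -lebesgue_tuple_cube ?ltrN10 ?(lt_trans (ltrN10 _))//.
  apply: le_measure; rewrite ?inE//; first exact: measurable_tuple_cube.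
  rewrite AE => t /= /andP[_ h] i.
  rewrite -ler_norml -(@expr_le1 _ 2)// real_normK ?num_real//.
  apply: le_trans h; rewrite (bigD1 i)//= lerDl.
  by apply: sumr_ge0 => j _; rewrite sqr_ge0.
have lo0 : 0 < (n%:R^-1 - (2 * n%:R)^-1) ^+ n :> R.
  apply: exprn_gt0; rewrite subr_gt0.
  by rewrite ltf_pV2 ?posrE ?mulr_gt0// ltr_pMl// ltr1n.
rewrite fine_gt0//; apply/andP; split.
  by rewrite mule_gt0// (lt_le_trans _ lo).
by rewrite lte_mul_pinfty// (le_lt_trans hi)// ltry.
Qed.

Lemma gamma_mt_gt0 n : (0 < n)%N -> 0 < gamma_mt R n.
Proof.
by move=> n0; rewrite /gamma_mt mulr_gt0 ?ltr0n// powR_gt0// omega_gt0.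
Qed.

End gamma_positive.

Section truncated_exponential.
Context {R : realType}.

Let cvg_tail m (t : R) :
  \sum_(0 <= k < N) t ^+ (k + m.+1) / (k + m.+1)`!%:R @[N --> \oo]
  --> exp_trunc m t.
Proof.
rewrite [X in X @ _](_ : _ = fun N =>
  \sum_(0 <= k < N + m.+1) t ^+ k / k`!%:R -
  \sum_(0 <= k < m.+1) t ^+ k / k`!%:R); last first.
  apply/funext => N.
  rewrite (@big_cat_nat _ _ _ m.+1 _ (N + m.+1))//= ?leq_addl// addrAC subrr add0r.
  by rewrite (@big_addn _ _ _ 0 _ m.+1) addnK.
apply: cvgB; last exact: cvg_cst.
rewrite (@cvg_shiftn _ _ (fun N => \sum_(0 <= k < N) t ^+ k / k`!%:R)).
exact: is_cvg_series_exp_coeff.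
Qed.

(** The first term that the truncation leaves in the exponential series. *)
Lemma exp_trunc_ge m (t : R) : 0 <= t -> t ^+ m.+1 / m.+1`!%:R <= exp_trunc m t.
Proof.
move=> t0; rewrite -(cvg_lim _ (@cvg_tail m t))//; apply: limr_ge.
  by apply/cvg_ex; exists (exp_trunc m t); exact: cvg_tail.
near=> N; have [k ->] : exists k, N = k.+1.
  by exists N.-1; rewrite prednK//; near: N; exists 1%N.
rewrite big_nat_recl// add0n lerDl; apply: sumr_ge0 => i _.
by rewrite divr_ge0// exprn_ge0.
Unshelve. all: by end_near. Qed.

(** Termwise, [t ^+ (k + m.+1) / (k + m.+1)`! <= t ^+ m.+1 * (t ^+ k / k`!)]. *)
Lemma exp_trunc_le m (t : R) : 0 <= t -> exp_trunc m t <= t ^+ m.+1 * expR t.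
Proof.
move=> t0; rewrite -(cvg_lim _ (@cvg_tail m t))//; apply: limr_le.
  by apply/cvg_ex; exists (exp_trunc m t); exact: cvg_tail.
near=> N.
apply: (@le_trans _ _ (t ^+ m.+1 * series (exp_coeff t) N)).
  rewrite /series /= mulr_sumr; apply: ler_sum => k _.
  rewrite exprD (mulrC (t ^+ k)) -mulrA ler_wpM2l ?exprn_ge0//.
  rewrite /exp_coeff ler_wpM2l ?exprn_ge0// lef_pV2 ?posrE ?ltr0n ?fact_gt0//.
  by rewrite ler_nat leq_fact// leq_addr.
rewrite ler_wpM2l ?exprn_ge0//; apply: nondecreasing_cvgn_le.
  apply/nondecreasing_series => k _ _; rewrite divr_ge0// exprn_ge0//.
exact: is_cvg_series_exp_coeff.
Unshelve. all: by end_near. Qed.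

Lemma exp_trunc_le_expR m (t : R) : 0 <= t -> exp_trunc m t <= expR t.
Proof.
move=> t0; rewrite /exp_trunc gerBl; apply: sumr_ge0 => k _.
by rewrite divr_ge0// exprn_ge0.
Qed.

Lemma continuous_exp_trunc m : continuous (@exp_trunc R m).
Proof.
move=> t; apply: cvgB; first exact: continuous_expR.
elim: m.+1 => [|k IH].
  by rewrite big_geq//; under eq_cvg do rewrite big_geq//; exact: cvg_cst.
rewrite big_nat_recr//=; under eq_cvg do rewrite big_nat_recr//=.
by apply: cvgD => //; apply: cvgMl; exact: exprn_continuous.
Qed.

End truncated_exponential.

(** * Smooth truncation on the real line *)

Section derivative_towers.
Context {R : realType}.
Implicit Types (F : nat -> R -> R) (P : {poly R}).

(** Smoothness on the real line is recorded by the whole sequence of iterated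
derivatives, since these are needed to differentiate a composition repeatedly. *)
Definition derivative_tower F : Prop :=
  forall k (x : R), is_derive x 1 (F k) (F k.+1 x).

Lemma derivative_tower_affine F (a b c : R) : derivative_tower F ->
  derivative_tower (fun k x => c * a ^+ k * F k (a * x + b)).
Proof.
move=> tF k x.
have h1 : is_derive x (1 : R) (fun x : R => a * x + b) a.
  by apply: is_derive_eq; rewrite addr0 [_ *: _]mulr1.
have h2 := @is_derive1_comp R (F k) (fun x => a * x + b) x _ _ (tF k (a * x + b)) h1.
have h3 := @is_deriveZ R R R _ (c * a ^+ k) x 1 _ h2.
apply: is_derive_eq h3 _.
by rewrite exprSr /GRing.scale /=; ring.
Qed.

Lemma derivative_towerB F G : derivative_tower F -> derivative_tower G ->
  derivative_tower (fun k x => F k x - G k x).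
Proof. by move=> tF tG k x; exact: is_deriveB (tF k x) (tG k x). Qed.

Lemma derivative_towerZ a F : derivative_tower F ->
  derivative_tower (fun k x => a * F k x).
Proof. by move=> tF k x; exact: is_deriveZ (tF k x). Qed.

Definition id_tower (k : nat) (x : R) : R :=
  if k is k'.+1 then (k' == 0%N)%:R else x.

Lemma derivative_tower_id : derivative_tower id_tower.
Proof.
move=> [|k] x; first exact: is_derive_id.
exact: is_derive_cst.
Qed.

(** The functions [P(1/x) exp(-1/x)], extended by zero, are stable under
differentiation, which makes [exp(-1/x)] smooth. *)
Definition flat_poly P (x : R) : R :=
  if 0 < x then P.[x^-1] * expR (- x^-1) else 0.

Lemma poly_expRN_bounded P : exists2 C, 0 <= C &
  forall y : R, 0 <= y -> `|P.[y]| * expR (- y) <= C.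
Proof.
exists (\sum_(i < size P) `|P`_i| * i`!%:R).
  by apply: sumr_ge0 => i _; rewrite mulr_ge0.
move=> y y0; rewrite expRN -ler_pdivlMr ?invr_gt0 ?expR_gt0// invrK.
rewrite horner_coef (le_trans (ler_norm_sum _ _ _))// mulr_suml.
apply: ler_sum => i _; rewrite normrM -mulrA ler_wpM2l//.
rewrite ger0_norm ?exprn_ge0// mulrC -ler_pdivrMr ?ltr0n ?fact_gt0//.
case: (nat_of_ord i) => [|k].
  by rewrite expr0 fact0 divr1 -expR0 ler_expR.
by rewrite (le_trans _ (expR_ge1Dxn k y0))// lerDr.
Qed.

(** The exponential absorbs the extra factor [x^-2]; the quadratic bound gives
the derivative at the origin. *)
Lemma flat_poly_small P : exists2 C, 0 <= C &
  forall x : R, `|flat_poly P x| <= C * x ^+ 2.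
Proof.
have [C C0 HC] := poly_expRN_bounded ('X^2 * P).
exists C => // x; rewrite /flat_poly; case: ifPn => [x0|_]; last first.
  by rewrite normr0 mulr_ge0// sqr_ge0.
have /HC : 0 <= x^-1 by rewrite invr_ge0 ltW.
rewrite hornerM hornerXn (normrM (_ ^+ 2)) normrX (normrM P.[_]) (ger0_norm (expR_ge0 _)).
rewrite (@gtr0_norm _ x^-1) ?invr_gt0// exprVn -mulrA.
by rewrite ler_pdivrMl ?exprn_gt0// (mulrC C).
Qed.

Lemma is_derive_flat_poly P (x : R) :
  is_derive x 1 (flat_poly P) (flat_poly ('X^2 * (P - P^`())) x).
Proof.
have [x0|x0|->] := ltgtP x 0.
- rewrite {2}/flat_poly ltNge (ltW x0) /=.
  apply: (@near_eq_is_derive R R R (cst 0)).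
  near=> y; rewrite /flat_poly ltNge ltW//=; near: y.
  exact: lt_nbhsl.
- rewrite {2}/flat_poly x0.
  apply: (@near_eq_is_derive R R R (fun y => P.[y^-1] * expR (- y^-1))).
    near=> y; rewrite /flat_poly ifT//; near: y.
    exact: lt_nbhsr.
  have xn0 : x != 0 by rewrite gt_eqF.
  have hV : is_derive x (1 : R) (fun y : R => y^-1) (- x ^- 2).
    have := @is_deriveV R id x 1 1 xn0 (is_derive_id _ _).
    by rewrite /GRing.scale/= mulr1.
  have hP := @is_derive1_comp R (horner P) _ x _ _ (is_derive_poly P x^-1) hV.
  have hN := @is_deriveN R R R _ x 1 _ hV.
  have hE := @is_derive1_comp R expR _ x _ _ (is_derive_expR (- x^-1)) hN.
  apply: is_derive_eq (is_deriveM hP hE) _.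
  rewrite !hornerE /GRing.scale /= -exprVn.
  by ring.
- rewrite {2}/flat_poly ltxx.
  have [C C0 HC] := flat_poly_small P.
  have H : (fun h : R => h^-1 *: (flat_poly P (h *: (1:R) + 0) - flat_poly P 0)) @ 0^' --> (0 : R).
    apply/cvgr0Pnorm_le => e e0.
    near=> h.
    have h0 : h != 0 by near: h; exact: nbhs_dnbhs_neq.
    rewrite {2}/flat_poly ltxx subr0 addr0 [_ *: 1]mulr1 normrM normfV.
    rewrite ler_pdivrMl ?normr_gt0// (le_trans (HC h))//.
    rewrite -real_normK ?num_real// expr2 mulrCA ler_wpM2l//.
    rewrite (@le_trans _ _ ((C + 1) * `|h|))// ?ler_wpM2r ?lerDl//.
    rewrite -ler_pdivlMl ?ltr_wpDl//.
    near: h; apply: dnbhs0_le; rewrite mulr_gt0// invr_gt0 ltr_wpDl//.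
  by apply: DeriveDef; [apply/cvg_ex; exists 0|apply: cvg_lim].
Unshelve. all: by end_near. Qed.

(** The polynomials attached, as in [flat_poly], to the successive derivatives
of [x exp(-1/x)], starting from the first one [(1 + 1/x) exp(-1/x)]. *)
Fixpoint soft_poly (k : nat) : {poly R} :=
  if k is k'.+1 then 'X^2 * (soft_poly k' - (soft_poly k')^`()) else 1 + 'X.

(** The function [x exp(-1/x)] is a smooth substitute for the positive part: it
vanishes for [x <= 0], stays within distance 1 of [x] for [x >= 0], and its
slope lies between 0 and 1. *)
Definition soft_tower (k : nat) (x : R) : R :=
  if k is k'.+1 then flat_poly (soft_poly k') x else x * flat_poly 1 x.

Lemma derivative_tower_soft : derivative_tower soft_tower.
Proof.
move=> [|k] x; last exact: is_derive_flat_poly.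
apply: is_derive_eq (is_deriveM (is_derive_id x 1) (is_derive_flat_poly 1 x)) _.
rewrite /GRing.scale /= /flat_poly; case: ifPn => [x0|]; last first.
  by rewrite !mulr0 !mul0r ?addr0.
have xn0 : x != 0 by rewrite gt_eqF.
rewrite derivC subr0 mulr1 !hornerE /=.
by field.
Qed.

Lemma soft_tower_le0 k x : x <= 0 -> soft_tower k x = 0.
Proof.
by move=> x0; case: k => [|k] /=; rewrite /flat_poly ltNge x0 /= ?mulr0.
Qed.

Lemma soft_ge0 x : 0 <= soft_tower 0 x.
Proof.
have [x0|x0] := leP x 0; first by rewrite soft_tower_le0.
by rewrite /= /flat_poly x0 hornerC mul1r mulr_ge0 ?expR_ge0 ?ltW.
Qed.

Lemma soft_le x : 0 <= x -> soft_tower 0 x <= x.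
Proof.
rewrite le_eqVlt => /predU1P[<-|x0]; first by rewrite soft_tower_le0.
rewrite /= /flat_poly x0 hornerC mul1r ler_piMr ?(ltW x0)//.
by rewrite -expR0 ler_expR oppr_le0 invr_ge0 ltW.
Qed.

Lemma soft_ge x : x - 1 <= soft_tower 0 x.
Proof.
have [x0|x0] := leP x 0.
  by rewrite soft_tower_le0// subr_le0 (le_trans x0).
rewrite /= /flat_poly x0 hornerC mul1r.
rewrite -[leLHS](_ : x * (1 - x^-1) = _).
  by rewrite ler_wpM2l ?(ltW x0)// expR_ge1Dx.
by rewrite mulrBr mulr1 divff// gt_eqF.
Qed.

(** For [x > 0] the slope is [(1 + y) exp(-y)] with [y = 1/x], and
[1 + y <= exp y]. *)
Lemma soft_derive_01 x : 0 <= soft_tower 1 x <= 1.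
Proof.
have [x0|x0] := leP x 0; first by rewrite soft_tower_le0 ?lexx ?ler01.
rewrite /= /flat_poly x0 !hornerE; apply/andP; split.
  by rewrite mulr_ge0 ?expR_ge0// addr_ge0// invr_ge0 ltW.
by rewrite expRN ler_pdivrMr ?expR_gt0// mul1r expR_ge1Dx.
Qed.

(** A smooth odd version of [sgn t * max(|t| - s, 0)], rescaled by [s] so that
the rounding error is at most [s]; the sign of the second term is the one that
the derivatives of an odd function require. *)
Definition excess_tower (s : R) (k : nat) (t : R) : R :=
  s * (s^-1) ^+ k * (soft_tower k (s^-1 * t - 1) -
    (-1) ^+ k * soft_tower k (- (s^-1 * t) - 1)).

(** The complement of the excess, a smooth version of the truncation of [t] at
heights [s] and [- s]. *)
Definition capped_tower (s : R) (k : nat) (t : R) : R :=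
  id_tower k t - excess_tower s k t.

Lemma derivative_tower_excess s : derivative_tower (excess_tower s).
Proof.
pose F k (x : R) := soft_tower k (x - 1) - (-1) ^+ k * soft_tower k (- x - 1).
have tF : derivative_tower F.
  move=> k x.
  have h1 := derivative_tower_affine 1 (-1) 1 derivative_tower_soft.
  have h2 := derivative_tower_affine (-1) (-1) 1 derivative_tower_soft.
  have := derivative_towerB h1 h2 k x.
  rewrite /F; under eq_fun do rewrite expr1n !mul1r mulN1r.
  by rewrite expr1n !mul1r mulN1r.
have := derivative_tower_affine s^-1 0 s tF.
by rewrite /F /excess_tower; under eq_fun do under eq_fun do rewrite addr0.
Qed.

Lemma derivative_tower_capped s : derivative_tower (capped_tower s).
Proof.
exact: derivative_towerB derivative_tower_id (derivative_tower_excess s).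
Qed.

Lemma excess_eq0 s t : 0 < s -> `|t| <= s -> excess_tower s 0 t = 0.
Proof.
move=> s0; rewrite ler_norml => /andP[h1 h2].
rewrite /excess_tower expr0 !soft_tower_le0 ?mulr0 ?subr0 ?mulr0//.
- by rewrite subr_le0 -mulrN ler_pdivrMl// mulr1 lerNl.
- by rewrite subr_le0 ler_pdivrMl// mulr1.
Qed.

Lemma excess_derive_01 s t : 0 < s -> 0 <= excess_tower s 1 t <= 1.
Proof.
move=> s0; rewrite /excess_tower !expr1 mulfV ?gt_eqF// mul1r mulN1r opprK.
set x := s^-1 * t.
have [x1|x1] := leP x 1.
  by rewrite soft_tower_le0 ?add0r ?soft_derive_01// subr_le0.
rewrite (@soft_tower_le0 1 (- x - 1)) ?addr0 ?soft_derive_01//.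
by rewrite -opprD oppr_le0 addr_ge0// ltW// (lt_trans _ x1).
Qed.

Lemma norm_excess s t : 0 < s ->
  `|excess_tower s 0 t| = s * soft_tower 0 (s^-1 * `|t| - 1).
Proof.
move=> s0; rewrite /excess_tower !expr0 mulr1 mul1r normrM gtr0_norm//.
congr (_ * _).
have [t0|t0] := leP 0 t.
  rewrite (ger0_norm t0) (@soft_tower_le0 0 (- _ - 1)) ?subr0 ?ger0_norm ?soft_ge0//.
  by rewrite -opprD oppr_le0 addr_ge0// mulr_ge0// invr_ge0 ltW.
rewrite (ltr0_norm t0) (@soft_tower_le0 0 (s^-1 * t - 1)) ?sub0r ?normrN.
  by rewrite mulrN ger0_norm ?soft_ge0.
by rewrite subr_le0 (@le_trans _ _ 0)// pmulr_rle0 ?invr_gt0// ltW.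
Qed.

Lemma excess_ge s t : 0 < s -> `|t| <= `|excess_tower s 0 t| + 2 * s.
Proof.
move=> s0; rewrite norm_excess//.
have := soft_ge (s^-1 * `|t| - 1).
rewrite -(ler_pM2l s0) 2!mulrBr mulrA mulfV ?gt_eqF// mul1r mulr1.
by move=> ?; lra.
Qed.

Lemma norm_excess_le s t : 0 < s -> s <= `|t| ->
  `|excess_tower s 0 t| <= `|t| - s.
Proof.
move=> s0 st; rewrite norm_excess//.
have : soft_tower 0 (s^-1 * `|t| - 1) <= s^-1 * `|t| - 1.
  by apply: soft_le; rewrite subr_ge0 ler_pdivlMl// mulr1.
rewrite -(ler_pM2l s0) => /le_trans; apply.
by rewrite mulrBr mulr1 mulVKf ?gt_eqF.
Qed.

Lemma excess_le s t : 0 < s -> `|excess_tower s 0 t| <= `|t|.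
Proof.
move=> s0; have [ts|ts] := leP `|t| s; first by rewrite excess_eq0 ?normr0.
by have := norm_excess_le s0 (ltW ts); lra.
Qed.

Lemma capped_ge s t : 0 < s -> s / 2 < `|t| -> s / 2 <= `|capped_tower s 0 t|.
Proof.
move=> s0 st; rewrite /capped_tower /=.
have [ts|ts] := leP `|t| s; first by rewrite excess_eq0// subr0 ltW.
apply: le_trans (lerB_dist _ _).
by have := norm_excess_le s0 (ltW ts); lra.
Qed.

Lemma capped_tower0 s : 0 < s -> capped_tower s 0 0 = 0.
Proof. by move=> s0; rewrite /capped_tower /= excess_eq0 ?subr0// normr0 ltW. Qed.

Lemma capped_tower1 s t : capped_tower s 1 t = 1 - excess_tower s 1 t.
Proof. by []. Qed.

End derivative_towers.

(** * Composition of smooth functions *)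

Section Ck_calculus.
Context {R : realType} {n : nat}.
Implicit Types (U : set 'rV[R]_n).

(** The derivatives [Ck] speaks of are functions on the whole space that are
only controlled on [U]; this makes them replaceable by formulas valid on [U]. *)
Lemma near_eq_differentiable (V W : normedModType R) (f g : V -> W) (x : V) :
  (\near x, f x = g x) -> differentiable f x -> differentiable g x.
Proof.
move=> fg df; have [cf ef] := (diff_locallyP x f).1 df.
have eg : g \o shift x = cst (g x) + 'd f x +o_ 0 id.
  apply/eqaddoP => e e0; move/eqaddoP: ef => /(_ e e0) ef.
  have fg0 : \forall h \near 0, f (h + x) = g (h + x).
    have : \forall h \near 0, f (x + h) = g (x + h) by rewrite (near_shift x) /=; near do rewrite /= sub0r addrC addrNK//.
    by apply: filterS => h; rewrite addrC.
  near=> h.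
  have h1 : f (h + x) = g (h + x) by near: h.
  rewrite -(_ : (f \o shift x - (cst (f x) + 'd f x)) h = (g \o shift x - (cst (g x) + 'd f x)) h).
    by near: h.
  by rewrite !fctE /= h1 (nbhs_singleton fg).
have d := diff_unique cf eg.
by apply/diff_locallyP; rewrite d.
Unshelve. all: by end_near. Qed.

Lemma Ck_eq (W : normedModType R) U (f g : 'rV[R]_n -> W) k : open U ->
  (forall x, U x -> f x = g x) -> Ck k U f -> Ck k U g.
Proof.
move=> oU; elim: k f g => [|k IH] f g fg.
  move=> /= cf x Ux; have fgx : \near x, f x = g x.
    by near=> y; apply: fg; near: y; exact: open_nbhs_nbhs.
  have := cf x Ux; rewrite /prop_for /continuous_at -(fg _ Ux).
  by apply: cvg_trans; exact: near_eq_cvg fgx.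
move=> [df Cf]; split=> [x Ux|i].
  apply: near_eq_differentiable (df x Ux).
  by near=> y; apply: fg; near: y; exact: open_nbhs_nbhs.
apply: IH (Cf i) => x Ux; apply: near_eq_derive.
by near=> y; apply: fg; near: y; exact: open_nbhs_nbhs.
Unshelve. all: by end_near. Qed.

Lemma CkS (W : normedModType R) U (f : 'rV[R]_n -> W) k : Ck k.+1 U f -> Ck k U f.
Proof.
elim: k f => [|k IH] f [df Cf] /=.
  by move=> x Ux; apply: differentiable_continuous; exact: df.
by split=> // i; apply: IH; exact: Cf.
Qed.

Lemma CkD (W : normedModType R) U (f g : 'rV[R]_n -> W) k : open U ->
  Ck k U f -> Ck k U g -> Ck k U (fun x => f x + g x).
Proof.
move=> oU; elim: k f g => [|k IH] f g /=.
  by move=> cf cg x Ux; exact: cvgD (cf x Ux) (cg x Ux).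
move=> [df Cf] [dg Cg]; split=> [x Ux|i].
  by apply: differentiableD; [exact: df|exact: dg].
apply: (@Ck_eq _ _ (fun x => 'D_(delta_mx ord0 i) f x + 'D_(delta_mx ord0 i) g x)) => //.
  by move=> x Ux; rewrite deriveD//; apply: diff_derivable; [exact: df|exact: dg].
by apply: IH; [exact: Cf|exact: Cg].
Qed.

Lemma CkM U (f g : 'rV[R]_n -> R) k : open U ->
  Ck k U f -> Ck k U g -> Ck k U (fun x => f x * g x).
Proof.
move=> oU; elim: k f g => [|k IH] f g.
  by move=> cf cg x Ux; exact: cvgM (cf x Ux) (cg x Ux).
move=> Cf1 Cg1; have [df Cf] := Cf1; have [dg Cg] := Cg1; split=> [x Ux|i].
  by apply: differentiableM; [exact: df|exact: dg].
apply: (@Ck_eq _ _ (fun x => f x * 'D_(delta_mx ord0 i) g x + g x * 'D_(delta_mx ord0 i) f x)) => //.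
  move=> x Ux; have h1 : derivable f x (delta_mx ord0 i) by apply: diff_derivable; exact: df.
  have h2 : derivable g x (delta_mx ord0 i) by apply: diff_derivable; exact: dg.
  by have := deriveM h1 h2.
exact: CkD oU (IH _ _ (CkS Cf1) (Cg i)) (IH _ _ (CkS Cg1) (Cf i)).
Qed.

Lemma derive_comp1 (V : normedModType R) (F : R -> R) (f : V -> R) x v (d : R) :
  is_derive (f x) 1 F d -> differentiable f x ->
  'D_v (F \o f) x = d * 'D_v f x.
Proof.
move=> [dF <-] df; have dF' : differentiable F (f x) by apply/derivable1_diffP.
rewrite deriveE; last exact: differentiable_comp.
by rewrite diff_comp//= (diff1E dF') derive1E (deriveE _ df) mulrC.
Qed.

(** The derivatives of [F 0 \o f] are products of [F 1 \o f] with derivatives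
of [f]; the induction passes to the shifted tower. *)
Lemma Ck_tower F U (f : 'rV[R]_n -> R) k : open U -> derivative_tower F ->
  Ck k U f -> Ck k U (F 0%N \o f).
Proof.
move=> oU; elim: k F => [|k IH] F tF.
  move=> cf x Ux; apply: continuous_comp; first exact: cf.
  by apply: differentiable_continuous; apply/derivable1_diffP; have [] := tF 0%N (f x).
move=> Cf1; have [df Cf] := Cf1; split=> [x Ux|i].
  apply: differentiable_comp; first exact: df.
  by apply/derivable1_diffP; have [] := tF 0%N (f x).
apply: (@Ck_eq _ _ (fun x => F 1%N (f x) * 'D_(delta_mx ord0 i) f x)) => //.
  by move=> x Ux; rewrite (derive_comp1 _ (tF 0%N (f x)))//; exact: df.
have CF := IH (fun k => F k.+1) (fun j => tF j.+1) (CkS Cf1).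
exact: CkM oU CF (Cf i).
Qed.

Lemma smooth_on_tower F U (f : 'rV[R]_n -> R) : open U -> derivative_tower F ->
  smooth_on U f -> smooth_on U (F 0%N \o f).
Proof. by move=> oU tF sf k; apply: Ck_tower => //; exact: sf. Qed.

Lemma smooth_on_differentiable (W : normedModType R) U (f : 'rV[R]_n -> W) x :
  smooth_on U f -> U x -> differentiable f x.
Proof. by move=> sf Ux; have [df _] := sf 1%N; exact: df. Qed.

Lemma smooth_on_continuous_derive (W : normedModType R) U (f : 'rV[R]_n -> W) x i :
  smooth_on U f -> U x -> {for x, continuous (fun x => 'D_(delta_mx ord0 i) f x)}.
Proof. by move=> sf Ux; have [_ Cf] := sf 1%N; exact: Cf. Qed.

End Ck_calculus.

(** * Gram matrices and Borel measurability *)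

Section gram_forms.
Context {R : realType} {n : nat}.
Implicit Types (A G : 'M[R]_n) (u v w : 'rV[R]_n).

Definition qform G v : R := (v *m G *m v^T) ord0 ord0.

Lemma qformE G v : qform G v = \sum_j (\sum_i v ord0 i * G i j) * v ord0 j.
Proof. by rewrite /qform mxE; apply: eq_bigr => j _; rewrite !mxE. Qed.

Lemma qformZ G c v : qform G (c *: v) = c ^+ 2 * qform G v.
Proof.
by rewrite /qform -scalemxAl linearZ/= -scalemxAr -scalemxAl !mxE mulrA expr2.
Qed.

Lemma qform_mul A G v : qform (A *m G *m A^T) v = qform G (v *m A).
Proof. by rewrite /qform trmx_mul !mulmxA. Qed.

Definition posdef G := G^T = G /\ forall v, v != 0 -> 0 < qform G v.

Lemma posdef_ge0 G v : posdef G -> 0 <= qform G v.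
Proof.
move=> [_ h]; have [->|/h/ltW//] := eqVneq v 0.
by rewrite /qform !mul0mx mxE.
Qed.

Lemma posdef_unitmx G : posdef G -> G \in unitmx.
Proof.
move=> [_ h]; rewrite -row_free_unit -kermx_eq0.
apply/rowV0P => v /sub_kermxP vG; apply/eqP/negPn/negP => /h.
by rewrite /qform vG mul0mx mxE ltxx.
Qed.

(** The Cauchy-Schwarz inequality, obtained from the minimum of
[t |-> qform G (u + t *: v)]. *)
Lemma qform_triangle G u v : posdef G ->
  Num.sqrt (qform G (u + v)) <= Num.sqrt (qform G u) + Num.sqrt (qform G v).
Proof.
move=> pG; have [symG h] := pG.
pose b : R := (u *m G *m v^T) ord0 ord0.
have bC : (v *m G *m u^T) ord0 ord0 = b.
  have e : (v *m G *m u^T)^T = u *m G *m v^T by rewrite !trmx_mul trmxK symG mulmxA.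
  by have := congr1 (fun B : 'M[R]_1 => B ord0 ord0) e; rewrite mxE.
have mxD00 (A B : 'M[R]_1) : (A + B) ord0 ord0 = A ord0 ord0 + B ord0 ord0 by rewrite mxE.
have mxZ00 c (A : 'M[R]_1) : (c *: A) ord0 ord0 = c * A ord0 ord0 by rewrite mxE.
have qD t : qform G (u + t *: v) = qform G u + 2 * t * b + t ^+ 2 * qform G v.
  rewrite /qform [(u + t *: v)^T]linearD /= [(t *: v)^T]linearZ /=.
  rewrite !mulmxDl !mulmxDr -!scalemxAr -!scalemxAl.
  by rewrite !(mxD00, mxZ00) bC -/b; ring.
have qu := posdef_ge0 u pG; have qv := posdef_ge0 v pG.
have CS : b <= Num.sqrt (qform G u) * Num.sqrt (qform G v).
  have [v0|v0] := eqVneq v 0.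
    by rewrite /b v0 linear0 mulmx0 mxE mulr_ge0.
  have qv0 := h _ v0.
  have := posdef_ge0 (u + (- b / qform G v) *: v) pG; rewrite qD => H.
  have {}H : b ^+ 2 <= qform G u * qform G v.
    rewrite -subr_ge0 (_ : _ - _ = qform G v * (qform G u + 2 * (- b / qform G v) * b + (- b / qform G v) ^+ 2 * qform G v)).
      by rewrite mulr_ge0.
    by field; rewrite gt_eqF.
  rewrite -sqrtrM// (le_trans (ler_norm b))// -sqrtr_sqr.
  exact: ler_wsqrtr.
rewrite -(@ler_pXn2r _ 2) ?nnegrE ?addr_ge0 ?sqrtr_ge0//.
rewrite sqrrD !sqr_sqrtr ?posdef_ge0//.
have := qD 1; rewrite scale1r => ->.
by lra.
Qed.

Lemma differential_row (W : normedModType R) (f : 'rV[R]_n -> W) x v :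
  differentiable f x ->
  'd f x v = \sum_k v ord0 k *: 'D_(delta_mx ord0 k) f x.
Proof.
move=> df; rewrite {1}(row_sum_delta v) linear_sum; apply: eq_bigr => k _.
by rewrite linearZ/= deriveE.
Qed.

End gram_forms.

Section measurable_matrix.
Context {R : realType}.

Lemma measurable_det m d (T : measurableType d) (D : set T) (A : T -> 'M[R]_m) :
  (forall i j, measurable_fun D (fun x => A x i j)) ->
  measurable_fun D (fun x => \det (A x)).
Proof.
move=> mA; rewrite /determinant; apply: measurable_sum => s.
apply: measurable_funM => //; apply: measurable_prod => i _; exact: mA.
Qed.

Lemma measurable_inv d (T : measurableType d) (D : set T) (f : T -> R) :
  measurable_fun D f -> measurable_fun D (fun x => (f x)^-1).
Proof.
move=> mf; apply: (@measurableT_comp _ _ _ _ _ _ (fun x : R => x^-1)) mf.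
have oD : open [set x : R | x != 0] by exact: open_neq.
rewrite (_ : setT = [set x : R | x != 0] `|` [set 0]).
  apply/measurable_funU => //; first exact: open_measurable.
  split; last exact: measurable_fun_set1.
  by apply: open_continuous_measurable_fun => // x; rewrite inE => /= x0; exact: inv_continuous.
by apply/esym; rewrite -subTset => x _; have [->|x0] := eqVneq x 0; [right|left].
Qed.

Lemma measurable_invmx m d (T : measurableType d) (D : set T) (A : T -> 'M[R]_m) i j :
  (forall x, D x -> A x \in unitmx) ->
  (forall i j, measurable_fun D (fun x => A x i j)) ->
  measurable_fun D (fun x => invmx (A x) i j).
Proof.
move=> uA mA.
apply: (@eq_measurable_fun _ _ _ _ _ (fun x => (\det (A x))^-1 * (\adj (A x)) i j)).
  by move=> x; rewrite inE => Dx; rewrite /invmx uA// [in RHS]mxE.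
apply: measurable_funM; first by apply: measurable_inv; exact: measurable_det.
under eq_fun do rewrite mxE.
apply: measurable_funM => //; apply: measurable_det => k l.
by under eq_fun do rewrite !mxE; exact: mA.
Qed.

End measurable_matrix.

Section borel_measurability.
Context {R : realType} {n : nat} (M : riemannianManifold R n).
Local Notation borel := (borel M).

Lemma open_measurable_borel (U : set M) : open U -> measurable (U : set borel).
Proof. by move=> oU; apply: sub_sigma_algebra. Qed.

Lemma continuous_on_measurable (D : set M) (f : M -> R) : open D ->
  (forall p, D p -> {for p, continuous f}) ->
  measurable_fun (D : set borel) (f : borel -> R).
Proof.
move=> oD cf mD; apply: (measurability _ (RGenOInfty.measurableE R)) => //.
move=> _ [_ [x ->] <-]; apply: open_measurable_borel.
suff : open ((D : set M) `&` (f : M -> R) @^-1` `]x, +oo[%classic) by [].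
rewrite openE => p /= [Dp]; rewrite in_itv/= andbT => fp.
apply: filterI; first exact: open_nbhs_nbhs.
have := cf p Dp `]x, +oo[%classic; apply.
by apply: open_nbhs_nbhs; split; [exact: interval_open|rewrite /= in_itv/= andbT].
Qed.

(** The preferred charts may be uncountably many and depend on the point in an
arbitrary way; a countable subfamily that covers is what measurability needs. *)
Lemma countable_chart_cover : exists s : nat -> M,
  forall p, exists k, chart_dom (pchart (s k)) p.
Proof.
have [B cB [oB hB]] := rm_second_countable M.
have /countable_injP[f finj] := cB.
pose s k := xget point [set q : M | exists U, [/\ B U, f U = k & U `<=` chart_dom (pchart q)]].
exists s => p.
have [U [BU Up] UD] := hB p _ (open_nbhs_nbhs (conj (chart_dom_open (pchart p)) (chart_atP p))).
exists (f U).
have [U' [BU' ff UD']] : [set q : M | exists U', [/\ B U', f U' = f U & U' `<=` chart_dom (pchart q)]] (s (f U)).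
  by rewrite /s; apply: xgetPex; exists p, U.
apply: UD'; suff -> : U' = U by [].
by apply: finj ff; rewrite inE.
Qed.

Lemma measurable_fun_charts d (T : measurableType d) (f : borel -> T) :
  (forall i, measurable_fun (chart_dom (atlas i) : set borel) f) ->
  measurable_fun setT f.
Proof.
move=> mf; have [s hs] := countable_chart_cover.
rewrite (_ : setT = \bigcup_k (chart_dom (pchart (s k)) : set borel)).
  apply/measurable_fun_bigcup => [k|k]; last exact: mf.
  by apply: open_measurable_borel; exact: chart_dom_open.
by apply/esym; rewrite -subTset => p _; have [k kp] := hs p; exists k.
Qed.

End borel_measurability.

(** * Gradients in charts *)

Section riemannian_gradient.
Context {R : realType} {n : nat} (M : riemannianManifold R n).
Local Notation borel := (borel M).
Implicit Types (i j : chart_index M) (p : M) (u : M -> R) (X Y : vfield M).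

Lemma chart_img_map i p : chart_dom (atlas i) p ->
  chart_img (atlas i) (chart_map (atlas i) p).
Proof. by move=> ip; exists p. Qed.

Lemma gram_posdef i x : chart_img (atlas i) x -> posdef (gram i x).
Proof.
by move=> ix; split=> [|v v0]; [exact: gram_sym|exact: gram_pos].
Qed.

(** The norm is defined in the preferred chart of each point, which varies
without any regularity; the change of coordinates of the metric moves it to a
fixed chart. *)
Lemma vnorm_chart X i p : chart_dom (atlas i) p ->
  vnorm X p = Num.sqrt (qform (gram i (chart_map (atlas i) p)) (vcomp X i p)).
Proof.
move=> ip; rewrite /vnorm -/(qform _ _).
by rewrite (gram_change (chart_atP p) ip) qform_mul.
Qed.

Lemma vnorm_ge0 X p : 0 <= vnorm X p.
Proof. exact: sqrtr_ge0. Qed.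

Lemma vnormZ (a : M -> R) X p : vnorm (fun q => a q *: X q) p = `|a p| * vnorm X p.
Proof.
rewrite /vnorm -!/(qform _ _) qformZ sqrtrM ?sqr_ge0// sqrtr_sqr.
by [].
Qed.

Lemma vnorm_triangle X Y p : vnorm (fun q => X q + Y q) p <= vnorm X p + vnorm Y p.
Proof.
by apply: qform_triangle; apply: gram_posdef; apply: chart_img_map; exact: chart_atP.
Qed.

Lemma vcompD X Y i p : vcomp (fun q => X q + Y q) i p = vcomp X i p + vcomp Y i p.
Proof. by rewrite /vcomp mulmxDl. Qed.

Lemma vcompZ a X i p : vcomp (fun q => a *: X q) i p = a *: vcomp X i p.
Proof. by rewrite /vcomp -scalemxAl. Qed.

Lemma measurable_vfieldD X Y : measurable_vfield X -> measurable_vfield Y ->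
  measurable_vfield (fun q => X q + Y q).
Proof.
move=> mX mY i k; under eq_fun do rewrite vcompD mxE.
by apply: measurable_funD; [exact: mX|exact: mY].
Qed.

Lemma measurable_vfieldZ a X : measurable_vfield X ->
  measurable_vfield (fun q => a *: X q).
Proof.
move=> mX i k; under eq_fun do rewrite vcompZ mxE.
by apply: measurable_funM => //; exact: mX.
Qed.

Lemma measurable_vfieldB X Y : measurable_vfield X -> measurable_vfield Y ->
  measurable_vfield (fun q => X q - Y q).
Proof.
move=> mX mY; have := measurable_vfieldD mX (measurable_vfieldZ (-1) mY).
by under eq_fun do rewrite scaleN1r.
Qed.

Lemma continuous_on_chart (W : topologicalType) i (f : 'rV[R]_n -> W) p :
  chart_dom (atlas i) p -> {for chart_map (atlas i) p, continuous f} ->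
  {for p, continuous (f \o chart_map (atlas i))}.
Proof.
by move=> ip cf; apply: continuous_comp => //; exact: chart_map_cont.
Qed.

Lemma measurable_gram i a b : measurable_fun (chart_dom (atlas i) : set borel)
  (fun p : borel => gram i (chart_map (atlas i) p) a b).
Proof.
apply: continuous_on_measurable; first exact: chart_dom_open.
move=> p ip; apply: (@continuous_on_chart _ i (fun x => gram i x a b)) => //.
apply: (@continuous_comp _ _ _ (gram i) (fun A : 'M[R]_n => A a b)); last exact: coord_continuous.
by have := gram_smooth (r := M) i 0%N; apply; exact: chart_img_map.
Qed.

(** In each fixed chart the norm is an algebraic expression in continuous and
measurable functions. *)
Lemma measurable_vnorm X : measurable_vfield X ->
  measurable_fun setT (vnorm X : borel -> R).
Proof.
move=> mX; apply: measurable_fun_charts => i.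
pose q (p : borel) := qform (gram i (chart_map (atlas i) p)) (vcomp X i p).
apply: (@eq_measurable_fun _ _ _ _ _ (fun p : borel => Num.sqrt (q p))).
  by move=> p; rewrite inE => ip; rewrite (vnorm_chart X ip).
apply: (@measurableT_comp _ _ _ _ _ _ (@Num.sqrt R)).
  by apply: continuous_measurable_fun; exact: sqrt_continuous.
rewrite /q; under eq_fun do rewrite qformE.
apply: measurable_sum => b; apply: measurable_funM; last exact: mX.
apply: measurable_sum => a; apply: measurable_funM; first exact: mX.
exact: measurable_gram.
Qed.

Lemma smooth_differentiable u i p : smooth u -> chart_dom (atlas i) p ->
  differentiable (u \o chart_inv (atlas i)) (chart_map (atlas i) p).
Proof.
move=> su ip; apply: smooth_on_differentiable (su i) _; exact: chart_img_map.
Qed.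

Lemma near_chart_dom i p : chart_dom (atlas i) p ->
  \forall q \near p, chart_dom (atlas i) q.
Proof. by move=> ip; exact: open_nbhs_nbhs (conj (chart_dom_open _) ip). Qed.

Lemma smooth_continuous u : smooth u -> continuous u.
Proof.
move=> su p; pose i := chart_at p; have ip : chart_dom (atlas i) p := chart_atP p.
have c1 : {for p, continuous ((u \o chart_inv (atlas i)) \o chart_map (atlas i))}.
  apply: continuous_on_chart => //.
  by apply: differentiable_continuous; exact: smooth_differentiable.
rewrite /continuous_at -{2}(chart_mapK ip).
apply: cvg_trans c1; apply: near_eq_cvg.
by apply: filterS (near_chart_dom ip) => q iq /=; rewrite chart_mapK.
Qed.

Lemma smooth_measurable u : smooth u -> measurable_fun setT (u : borel -> R).
Proof.
move=> su; apply: continuous_on_measurable => [|p _]; first exact: openT.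
exact: smooth_continuous.
Qed.

Definition partials (f : 'rV[R]_n -> R) x : 'rV[R]_n :=
  \row_k 'D_(delta_mx ord0 k) f x.

(** The gradient is intrinsic: the row of partial derivatives is multiplied by
the transposed Jacobian of the transition map, and the metric by the Jacobian
and its transpose, so that the Jacobians cancel. *)
Lemma vcomp_grad u i p : smooth u -> chart_dom (atlas i) p ->
  let x := chart_map (atlas i) p in
  vcomp (grad u) i p = partials (u \o chart_inv (atlas i)) x *m invmx (gram i x).
Proof.
move=> su ip x; rewrite /vcomp /grad -/(partials _ _) /pchart.
set c := chart_at p; set y := chart_map (atlas c) p.
have cp : chart_dom (atlas c) p := chart_atP p.
set T := transition _ _; set J := 'J T y.
have yp : chart_inv (atlas c) y = p by rewrite chart_mapK.
have Ty : T y = x by rewrite /T /transition /= yp.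
have dT : differentiable T y.
  by apply: smooth_on_differentiable (atlas_smooth c i) _; exists p.
have du : differentiable (u \o chart_inv (atlas i)) (T y).
  by rewrite Ty; exact: smooth_differentiable.
have uE : \forall z \near y, ((u \o chart_inv (atlas i)) \o T) z = (u \o chart_inv (atlas c)) z.
  have : \forall z \near y, chart_dom (atlas i) (chart_inv (atlas c) z).
    have := @chart_inv_cont _ _ _ (atlas c) y (chart_img_map cp).
    by apply; rewrite /= yp; exact: near_chart_dom.
  by apply: filterS => z iz /=; rewrite /T /transition /= chart_mapK.
have pE : partials (u \o chart_inv (atlas c)) y =
          partials (u \o chart_inv (atlas i)) x *m J^T.
  apply/rowP => k; rewrite [LHS]mxE -(near_eq_derive _ uE).
  rewrite deriveE; last exact: differentiable_comp.
  rewrite diff_comp//= differential_row// Ty mxE; apply: eq_bigr => l _.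
  rewrite [in RHS]mxE mulrC; congr (_ * _); rewrite mxE.
  by rewrite -deriveE// deriveEjacobian// -rowE mxE.
have G := gram_change cp ip; rewrite -/y -/x -/T -/J in G.
have uc : gram c y \in unitmx.
  by apply: posdef_unitmx; apply: gram_posdef; exact: chart_img_map.
have ui : gram i x \in unitmx.
  by apply: posdef_unitmx; apply: gram_posdef; exact: chart_img_map.
have uJ : J \in unitmx.
  by move: uc; rewrite G -mulmxA unitmx_mul => /andP[].
have uJT : J^T \in unitmx by rewrite unitmx_tr.
rewrite pE G; set D := partials _ _.
apply: (canRL (mulmxK ui)).
apply: (can_inj (mulmxK uJT)).
rewrite -!mulmxA (mulmxA J) -G.
by rewrite mulVmx// mulmx1.
Qed.

Lemma measurable_grad u : smooth u -> measurable_vfield (grad u).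
Proof.
move=> su i k.
apply: (@eq_measurable_fun _ _ _ _ _ (fun p : borel =>
  \sum_l partials (u \o chart_inv (atlas i)) (chart_map (atlas i) p) ord0 l *
    invmx (gram i (chart_map (atlas i) p)) l k)).
  by move=> p; rewrite inE => ip; rewrite (vcomp_grad su ip) mxE.
apply: measurable_sum => l; apply: measurable_funM.
  under eq_fun do rewrite mxE.
  apply: continuous_on_measurable; first exact: chart_dom_open.
  move=> p ip; apply: (@continuous_on_chart _ i ('D_(delta_mx ord0 l) (u \o chart_inv (atlas i)))) => //.
  apply: smooth_on_continuous_derive (su i) _; exact: chart_img_map.
apply: measurable_invmx => [p ip|a b].
  by apply: posdef_unitmx; apply: gram_posdef; exact: chart_img_map.
exact: measurable_gram.
Qed.

Lemma smooth_tower F u : derivative_tower F -> smooth u -> smooth (F 0%N \o u).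
Proof.
move=> tF su i; apply: (@smooth_on_tower _ _ F _ (u \o chart_inv (atlas i))) => //.
exact: chart_img_open.
Qed.

Lemma grad_tower F u : derivative_tower F -> smooth u ->
  grad (F 0%N \o u) = fun p => F 1%N (u p) *: grad u p.
Proof.
move=> tF su; apply/funext => p; rewrite /grad scalemxAl; congr (_ *m _).
apply/rowP => k; rewrite !mxE.
have d := smooth_differentiable su (chart_atP p).
have e : u p = (u \o chart_inv (pchart p)) (chart_map (pchart p) p).
  by rewrite /= chart_mapK//; exact: chart_atP.
rewrite e -(derive_comp1 _ (tF 0%N _) d).
by [].
Qed.

(** Since [F 0 0 = 0], composition does not enlarge the support. *)
Lemma test_function_tower F (Omega : set M) u : derivative_tower F ->
  F 0%N 0 = 0 -> test_function Omega u -> test_function Omega (F 0%N \o u).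
Proof.
move=> tF F0 [su cu uO].
have sub : closure [set p | F 0%N (u p) != 0] `<=` closure [set p | u p != 0].
  by apply: closure_subset => p /=; apply: contra_neq => ->.
split; first exact: smooth_tower.
  exact: subclosed_compact (@closed_closure _ _) cu sub.
exact: subset_trans sub uO.
Qed.

End riemannian_gradient.

(** * Compact sets are bounded *)

Section riemannian_boundedness.
Context {R : realType} {n : nat} (M : riemannianManifold R n).

Lemma qform_le (G : 'M[R]_n) (v : 'rV[R]_n) :
  qform G v <= n%:R ^+ 2 * (`|G| * `|v| ^+ 2).
Proof.
rewrite qformE.
have coord m k (A : 'M[R]_(m, k)) a b : `|A a b| <= `|A|.
  rewrite [leRHS]/Num.Def.normr/= mx_normrE.
  exact: (le_bigmax _ (fun ij => `|A ij.1 ij.2|) (a, b)).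
rewrite expr2 -mulrA !mulr_natl.
rewrite -[X in _ *+ X]card_ord -sumr_const; apply: ler_sum => b _.
rewrite mulr_suml -[X in _ *+ X]card_ord -sumr_const; apply: ler_sum => a _.
apply: le_trans (ler_norm _) _; rewrite !normrM expr2 mulrAC mulrC.
by rewrite ler_pM ?mulr_ge0// ler_pM.
Qed.

Lemma is_derive_line (x w : 'rV[R]_n) (t : R) :
  is_derive t 1 (fun t : R => x + t *: w) w.
Proof.
have d : is_diff t (cst x + (fun t : R => t *: w)) (0 + (fun t : R => t *: w)).
  exact: is_diffD.
apply: DeriveDef; first by apply: diff_derivable; exact: ex_diff.
by rewrite deriveE ?diff_val ?fctE ?add0r ?scale1r//; exact: ex_diff.
Qed.

(** A straight segment in a chart is a curve whose length is at most the supremum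
of its speed. *)
Lemma segment_piece i (x y : 'rV[R]_n) (K : R) : 0 <= K ->
  (forall t : R, 0 <= t <= 1 -> chart_img (atlas i) (x + t *: (y - x))) ->
  (forall t : R, 0 <= t <= 1 -> qform (gram i (x + t *: (y - x))) (y - x) <= K ^+ 2) ->
  exists2 l, C1_piece (chart_inv (atlas i) x : M) (chart_inv (atlas i) y) l & (l <= K%:E)%E.
Proof.
move=> K0 img bnd; pose c (t : R) : 'rV[R]_n := x + t *: (y - x).
have dc (t : R) : is_derive t 1 c (y - x) by exact: is_derive_line.
have dcE : derive1 c = cst (y - x).
  by apply/funext => t; rewrite derive1E; apply: derive_val.
exists (\int[lebesgue_measure]_(t in `[0%R, 1%R]) (Num.sqrt
              ((derive1 c t *m gram i (c t) *m (derive1 c t)^T) ord0 ord0))%:E)%E.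
  exists i, c; split => //.
  - by split; [move=> t; exact: ex_derive|rewrite dcE; exact: cst_continuous].
  - by rewrite /c scale0r addr0.
  - by rewrite /c scale1r addrC subrK.
rewrite dcE.
have cc : continuous c.
  move=> t; apply: differentiable_continuous; apply/derivable1_diffP.
  exact: ex_derive.
have oD : open (c @^-1` chart_img (atlas i)).
  by apply: open_comp; [move=> t _; exact: cc|exact: chart_img_open].
have mf : measurable_fun (c @^-1` chart_img (atlas i))
    (fun t : measurableTypeR R => Num.sqrt (qform (gram i (c t)) (y - x))).
  apply: (@measurableT_comp _ _ _ _ _ _ (@Num.sqrt R)).
    by apply: continuous_measurable_fun; exact: sqrt_continuous.
  under eq_fun do rewrite qformE.
  apply: measurable_sum => b; apply: measurable_funM => //.
  apply: measurable_sum => a; apply: measurable_funM => //.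
  apply: open_continuous_measurable_fun => // t; rewrite inE => /= ct.
  apply: (@continuous_comp _ _ _ c (fun z => gram i z a b)); first exact: cc.
  apply: (@continuous_comp _ _ _ (gram i) (fun A : 'M[R]_n => A a b)); last exact: coord_continuous.
  by have := gram_smooth (r := M) i 0%N; apply.
apply: (@le_trans _ _ (\int[lebesgue_measure]_(t in `[0%R, 1%R]) K%:E)%E).
  apply: ge0_le_integral => //.
  - apply/measurable_EFinP; apply: measurable_funS mf; first exact: open_measurable.
    by move=> t /=; rewrite in_itv/=; exact: img.
  - move=> t /=; rewrite in_itv/= => t01; rewrite lee_fin.
    by rewrite -(ger0_norm K0) -sqrtr_sqr; apply: ler_wsqrtr; exact: bnd.
rewrite integral_cst//.
have := @lebesgue_measure_itv R `[0, 1]; rewrite /= lte_fin ltr01 -EFinB subr0 => ->.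
by rewrite mule1.
Qed.

(** Near [p] the Gram matrices of a chart are bounded, hence short segments in
the chart are short curves. *)
Lemma near_rdist (p : M) : \forall q \near p, (rdist p q < 1%:E)%E.
Proof.
pose i := chart_at p; pose x := chart_map (atlas i) p.
have ip : chart_dom (atlas i) p := chart_atP p.
have ix : chart_img (atlas i) x by exact: chart_img_map.
have cG : {for x, continuous (gram i)}.
  by have := gram_smooth (r := M) i 0%N; apply.
pose K := `|gram i x| + 1; have K0 : 0 < K by rewrite ltr_wpDl.
have : \forall z \near x, chart_img (atlas i) z /\ `|gram i z| <= K.
  near=> z; split.
    by near: z; apply: open_nbhs_nbhs; split => //; exact: chart_img_open.
  rewrite -(subrK (gram i x) (gram i z)) /K addrC.
  rewrite (le_trans (ler_normD _ _))// lerD2l distrC.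
  by near: z; have /cvgrPdist_le := cG; apply.
move=> /nbhs_ballP[r /= r0 Hr].
pose d := (2 * (n%:R ^+ 2 * K + 1))^-1.
have L0 : 0 < n%:R ^+ 2 * K + 1 by rewrite ltr_wpDl// mulr_ge0 ?sqr_ge0// ltW.
have d0 : 0 < d by rewrite invr_gt0 mulr_gt0.
have near_map : \forall q \near p, `|x - chart_map (atlas i) q| < Num.min 1 (Num.min d r).
  have : chart_map (atlas i) q @[q --> p] --> x by exact: chart_map_cont.
  by move/cvgrPdist_lt; apply; rewrite !lt_min ltr01 d0.
near=> q.
have iq : chart_dom (atlas i) q by near: q; exact: near_chart_dom.
have : `|x - chart_map (atlas i) q| < Num.min 1 (Num.min d r).
  by near: q; exact: near_map.
set y := chart_map (atlas i) q.
rewrite !lt_min distrC => /and3P[w1 wd wr].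
have seg t : 0 <= t <= 1 -> ball x r (x + t *: (y - x)).
  move=> /andP[t0 t1]; rewrite -ball_normE/= opprD addrA subrr sub0r normrN.
  by rewrite normrZ (ger0_norm t0) (le_lt_trans _ wr)// ler_piMl.
have img t : 0 <= t <= 1 -> chart_img (atlas i) (x + t *: (y - x)).
  by move=> /seg /Hr[].
have bnd t : 0 <= t <= 1 -> qform (gram i (x + t *: (y - x))) (y - x) <= 2^-1.
  move=> /seg /Hr[_ gK]; apply: le_trans (qform_le _ _) _.
  apply: (@le_trans _ _ ((n%:R ^+ 2 * K + 1) * d)).
    rewrite mulrA ler_pM ?mulr_ge0 ?sqr_ge0//.
      by rewrite ler_wpDr// ler_wpM2l ?sqr_ge0.
    by rewrite expr2 (le_trans _ (ltW wd))// ler_piMl// ltW.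
  by rewrite /d invfM mulrCA mulfV ?gt_eqF// mulr1.
have [||l pl l2] := @segment_piece i x y (Num.sqrt 2^-1) _ img.
- exact: sqrtr_ge0.
- by move=> t t01; rewrite sqr_sqrtr ?bnd// invr_ge0.
move: pl; rewrite /x /y !chart_mapK// => pl.
have : curve_length p q (l + 0)%E by apply: curve_cons pl _; exact: curve_nil.
move=> cl; apply: (@le_lt_trans _ _ (l + 0)%E); first exact: ereal_inf_lbound.
rewrite adde0 (le_lt_trans l2)// lte_fin -[ltRHS]sqrtr1 ltr_sqrt//.
by rewrite invf_lt1 ?ltr1n.
Unshelve. all: by end_near. Qed.

Lemma compact_rbounded (K : set M) : compact K -> rbounded K.
Proof.
rewrite compact_cover => /(_ M setT (fun p => [set q | (rdist p q < 1%:E)%E]^°)).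
case=> [p _|q Kq|D _ hD]; first exact: open_interior.
  by exists q => //; exact: near_rdist.
exists (finmap.enum_fset D), 1 => q /hD[p /= pD pq]; exists p => //.
exact: (interior_subset pq).
Qed.

Lemma rbounded_subset (E F : set M) : E `<=` F -> rbounded F -> rbounded E.
Proof. by move=> EF [s [r h]]; exists s, r => q /EF; exact: h. Qed.

End riemannian_boundedness.

(** * Integrals of powers *)

Section power_integral.
Context d (T : measurableType d) (R : realType) (mu : {measure set T -> \bar R}).
Variable n : nat.
Hypothesis n0 : (0 < n)%N.
Implicit Types f g : T -> R.

Definition npow f : \bar R := (\int[mu]_x (`|f x| ^+ n)%:E)%E.

Local Notation N f := (Lnorm mu n%:R%:E (fun x => (f x)%:E)).

Let nR0 : n%:R != 0 :> R. Proof. by rewrite pnatr_eq0 -lt0n. Qed.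

Lemma npow_ge0 f : (0 <= npow f)%E.
Proof. by apply: integral_ge0 => x _; rewrite lee_fin exprn_ge0. Qed.

Lemma Lnorm_npow f : (N f `^ n%:R)%E = npow f.
Proof.
rewrite poweR_Lnorm//; apply: eq_integral => x _.
by rewrite abse_EFin poweR_EFin powR_mulrn.
Qed.

Lemma npow_Lnorm f : N f = (npow f `^ n%:R^-1)%E.
Proof. by rewrite -Lnorm_npow -poweRrM mulfV// poweRe1// Lnorm_ge0. Qed.

Lemma poweR_homo (r : R) (x y : \bar R) : 0 <= r -> (0 <= x)%E -> (x <= y)%E ->
  (x `^ r <= y `^ r)%E.
Proof.
move=> r0 x0 xy; apply: gt0_ler_poweR => //; rewrite in_itv/= leey andbT//.
exact: le_trans xy.
Qed.

Lemma Lnorm_le_npow f c : 0 <= c -> (N f <= c%:E)%E <-> (npow f <= (c ^+ n)%:E)%E.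
Proof.
move=> c0; split=> h.
  rewrite -Lnorm_npow -powR_mulrn// -poweR_EFin.
  by apply: poweR_homo => //; exact: Lnorm_ge0.
have -> : c = (c ^+ n) `^ n%:R^-1 by rewrite -powR_mulrn// -powRrM mulfV// powRr1.
rewrite npow_Lnorm -poweR_EFin.
by apply: poweR_homo => //; rewrite ?invr_ge0// npow_ge0.
Qed.

Lemma measurable_npow f : measurable_fun setT f ->
  measurable_fun setT (fun x => (`|f x| ^+ n)%:E).
Proof.
move=> mf; apply/measurable_EFinP; apply: measurable_funX.
exact: measurableT_comp.
Qed.

Lemma npowZ f (a : R) : measurable_fun setT f ->
  npow (fun x => a * f x) = ((`|a| ^+ n)%:E * npow f)%E.
Proof.
move=> mf; rewrite /npow -ge0_integralZl//=.
- by apply: eq_integral => x _; rewrite normrM exprMn.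
- exact: measurable_npow.
Qed.

Lemma LnormZ f (a : R) : measurable_fun setT f ->
  N (fun x => a * f x) = (`|a|%:E * N f)%E.
Proof.
move=> mf; rewrite !npow_Lnorm npowZ// poweRM ?npow_ge0 ?lee_fin ?exprn_ge0//.
by rewrite poweR_EFin -powR_mulrn// -powRrM mulfV// powRr1.
Qed.

Lemma npow_le f g : measurable_fun setT f -> measurable_fun setT g ->
  (forall x, `|f x| <= `|g x|) -> (npow f <= npow g)%E.
Proof.
move=> mf mg fg; apply: ge0_le_integral => //.
- exact: measurable_npow.
- exact: measurable_npow.
- by move=> x _; rewrite lee_fin lerXn2r ?nnegrE.
Qed.

Lemma Lnorm_le f g : measurable_fun setT f -> measurable_fun setT g ->
  (forall x, `|f x| <= `|g x|) -> (N f <= N g)%E.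
Proof.
move=> mf mg fg; rewrite !npow_Lnorm; apply: poweR_homo.
- by rewrite invr_ge0.
- exact: npow_ge0.
- exact: npow_le.
Qed.

Lemma LnormD f g : measurable_fun setT f -> measurable_fun setT g ->
  (N (fun x => (f x + g x)%R) <= N f + N g)%E.
Proof. by move=> mf mg; apply: minkowski_EFin => //; rewrite ler1n. Qed.

Lemma measurable_norm_ge f (c : R) : measurable_fun setT f ->
  measurable [set x | c <= `|f x|].
Proof.
move=> mf; rewrite (_ : [set x | _] = (fun x => `|f x|) @^-1` `[c, +oo[); last first.
  by apply/seteqP; split => x /=; rewrite in_itv/= andbT.
rewrite -[X in measurable X]setTI.
have mf' : measurable_fun setT (fun x => `|f x|) by exact: measurableT_comp.
exact: mf'.
Qed.

Lemma npow_chebyshev f (c : R) : measurable_fun setT f -> 0 <= c ->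
  ((c ^+ n)%:E * mu [set x | (c <= `|f x|)%R] <= npow f)%E.
Proof.
move=> mf c0; set A := [set x | _].
have mA : measurable A by exact: measurable_norm_ge.
rewrite -integral_cst//.
apply: (@le_trans _ _ (\int[mu]_(x in A) (`|f x| ^+ n)%:E)%E).
  apply: ge0_le_integral => //.
  - by move=> x _; rewrite lee_fin exprn_ge0.
  - by apply: measurable_funTS; exact: measurable_npow.
  - by move=> x /= cx; rewrite lee_fin lerXn2r ?nnegrE.
by apply: ge0_subset_integral => //; exact: measurable_npow.
Qed.

(** The sum of the [`|h k| ^+ n] is integrable, hence finite almost everywhere,
and then its terms tend to zero. *)
Lemma ae_cvg_npow_summable (h : nat -> T -> R) :
  (forall k, measurable_fun setT (h k)) ->
  (forall k, npow (h k) <= (1 / (2 ^ k.+1)%:R)%:E)%E ->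
  {ae mu, forall x, h k x @[k --> \oo] --> 0}.
Proof.
move=> mh hb.
pose S x : \bar R := (\sum_(k <oo) (`|h k x| ^+ n)%:E)%E.
have h0 k x : (0 <= (`|h k x| ^+ n)%:E)%E by rewrite lee_fin exprn_ge0.
have mS : measurable_fun setT S.
  by apply: ge0_emeasurable_sum => // k _; exact: measurable_npow.
have S0 x : (0 <= S x)%E by apply: nneseries_ge0 => k _ _.
have Sint : (\int[mu]_x S x <= 1%:E)%E.
  rewrite integral_nneseries//; last by move=> k; exact: measurable_npow.
  apply: le_trans (epsilon_trick0 xpredT ler01); apply: lee_nneseries => k _.
    by move=> _; exact: npow_ge0.
  exact: hb.
have iS : mu.-integrable setT S.
  apply/integrableP; split => //.
  under eq_integral do rewrite gee0_abs//.
  by apply: le_lt_trans Sint _; rewrite ltry.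
have := integrable_ae measurableT iS.
apply: filterS => x /(_ I) Sx.
have bnd k : `|h k x| ^+ n <= fine (S x) - \sum_(0 <= j < k) `|h j x| ^+ n.
  rewrite lerBrDl -lee_fin fineK//.
  apply: le_trans (nneseries_lim_ge k.+1 (fun _ _ _ => h0 _ x)).
  by rewrite sumEFin big_nat_recr.
have cs : cvgn (series (fun k => `|h k x| ^+ n)).
  apply: nondecreasing_is_cvgn.
    by apply: nondecreasing_series => k _ _; rewrite exprn_ge0.
  exists (fine (S x)) => _ [k _ <-]; rewrite /series/=.
  by have := le_trans (exprn_ge0 n (normr_ge0 (h k x))) (bnd k); rewrite subr_ge0.
have /cvgr0Pnorm_lt c0 := cvg_series_cvg_0 cs.
apply/cvgr0Pnorm_lt => e e0.
near=> k.
rewrite -(@ltr_pXn2r _ n) ?nnegrE//; last exact: ltW.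
rewrite -[ltLHS]ger0_norm ?exprn_ge0//.
by near: k; apply: c0; rewrite exprn_gt0.
Unshelve. all: by end_near. Qed.

Lemma cvge0_near_le (v : nat -> \bar R) (e : R) : v k @[k --> \oo] --> 0%E ->
  0 < e -> \forall k \near \oo, (v k <= e%:E)%E.
Proof.
move=> /fine_cvgP[fv /cvgr0Pnorm_le cv] e0; near=> k.
have fk : v k \is a fin_num by near: k.
rewrite -(fineK fk) lee_fin (le_trans (ler_norm _))//; near: k; exact: cv.
Unshelve. all: by end_near. Qed.

Lemma le_integral_ae_cvg (D : set T) (f : nat -> T -> \bar R) (l : T -> \bar R) (K : \bar R) :
  measurable D -> (forall j, measurable_fun D (f j)) -> measurable_fun D l ->
  (forall j x, D x -> 0 <= f j x)%E -> (forall x, D x -> 0 <= l x)%E ->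
  {ae mu, forall x, D x -> f j x @[j --> \oo] --> l x} ->
  (forall j, \int[mu]_(x in D) f j x <= K)%E -> (\int[mu]_(x in D) l x <= K)%E.
Proof.
move=> mD mf ml f0 l0 fl fK.
apply: (@le_trans _ _ (\int[mu]_(x in D) limn_einf (f^~ x))%E).
  apply: ae_ge0_le_integral => //.
  - move=> x Dx; rewrite limn_einf_lim; apply: lime_ge; first exact: is_cvg_einfs.
    by apply: nearW => j; apply: le_ereal_inf_tmp => _ [k _ <-]; exact: f0.
  - apply: measurableT_comp => //; apply: measurable_fun_limn_esup => j.
    exact: measurableT_comp.
  by apply: filterS fl => x fx Dx; rewrite (cvg_limn_einf_sup (fx Dx)).
apply: (le_trans (fatou mu mD mf f0)).
rewrite limn_einf_lim; apply: lime_le; first exact: is_cvg_einfs.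
apply: nearW => j; apply: le_trans (fK j); apply: ereal_inf_lbound.
by exists j => /=.
Qed.

End power_integral.

(** * Sobolev functions *)

Section sobolev_lemmas.
Context {R : realType} {n : nat} (M : riemannianManifold R n).
Local Notation borel := (borel M).
Variable mu : {measure set borel -> \bar R}.
Hypothesis n0 : (0 < n)%N.
Implicit Types (u : M -> R) (X : vfield M) (Omega : set M).

Lemma smoothZ a u : smooth u -> smooth (fun p => a * u p).
Proof. exact: (smooth_tower (derivative_towerZ a (@derivative_tower_id R))). Qed.

Lemma gradZ a u : smooth u -> grad (fun p => a * u p) = fun p => a *: grad u p.
Proof.
move=> su; apply: etrans (grad_tower (derivative_towerZ a (@derivative_tower_id R)) su) _.
by apply/funext => p; rewrite /= mulr1.
Qed.

Lemma test_functionZ a Omega u : test_function Omega u ->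
  test_function Omega (fun p => a * u p).
Proof.
apply: (test_function_tower (derivative_towerZ a (@derivative_tower_id R))).
exact: mulr0.
Qed.

Lemma norm_n0 : norm_n mu (fun=> 0) = 0%E.
Proof.
by have := @Lnorm0 _ _ _ mu n%:R%:E; apply; rewrite eqe pnatr_eq0 -lt0n.
Qed.

Lemma vnorm0 p : vnorm (fun q : M => 0 : 'rV[R]_n) p = 0.
Proof. by rewrite /vnorm !mul0mx mxE sqrtr0. Qed.

Lemma norm_nZ a u : measurable_fun setT (u : borel -> R) ->
  norm_n mu (fun p => a * u p) = (`|a|%:E * norm_n mu u)%E.
Proof. exact: LnormZ. Qed.

(** A test function is its own approximating sequence. *)
Lemma W1n0_test_function Omega u : test_function Omega u ->
  (norm_n mu u < +oo)%E -> (norm_n mu (vnorm (grad u)) < +oo)%E ->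
  W1n0 mu Omega u (grad u).
Proof.
move=> tu fu fgu; have [su _ _] := tu.
have cst_cvg : sobolev_cvg mu (fun=> u) u (grad u).
  split.
    under eq_fun do under [X in norm_n mu X]eq_fun do rewrite subrr.
    by rewrite norm_n0; exact: cvg_cst.
  rewrite (_ : vnorm _ = fun=> 0); last first.
    by apply/funext => p; under [X in vnorm X p]eq_fun do rewrite subrr; exact: vnorm0.
  by rewrite norm_n0; exact: cvg_cst.
split; last by exists (fun=> u).
split; [exact: smooth_measurable|exact: measurable_grad|].
by exists (fun=> u).
Qed.

Lemma vnormZr a X p : vnorm (fun q => a *: X q) p = `|a| * vnorm X p.
Proof. exact: (vnormZ (fun=> a)). Qed.

Lemma norm_vnormZ a X : measurable_vfield X ->
  norm_n mu (vnorm (fun q => a *: X q)) = (`|a|%:E * norm_n mu (vnorm X))%E.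
Proof.
move=> mX; rewrite -[X in (X%:E * _)%E]normr_id -LnormZ//; last exact: measurable_vnorm.
by congr Lnorm; apply/funext => p; rewrite vnormZr.
Qed.

Lemma sobolev_cvgZ a phi u X : (forall k, smooth (phi k)) ->
  measurable_fun setT (u : borel -> R) -> measurable_vfield X ->
  sobolev_cvg mu phi u X ->
  sobolev_cvg mu (fun k p => a * phi k p) (fun p => a * u p) (fun p => a *: X p).
Proof.
move=> sphi mu_u mX [c1 c2]; split.
  rewrite (_ : (fun k => _) = fun k => (`|a|%:E * norm_n mu (fun p => (phi k p - u p)%R))%E).
    rewrite -[X in _ --> X](mule0 `|a|%:E).
    by apply: cvgeZl.
  apply/funext => k; rewrite -LnormZ//.
    by congr Lnorm; apply/funext => p; rewrite mulrBr.
  by apply: measurable_funB => //; exact: smooth_measurable.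
rewrite (_ : (fun k => _) = fun k => (`|a|%:E * norm_n mu (vnorm (fun p => (grad (phi k) p - X p)%R)))%E).
  rewrite -[X in _ --> X](mule0 `|a|%:E).
  by apply: cvgeZl.
apply/funext => k; rewrite -norm_vnormZ//.
  by congr (norm_n _ (vnorm _)); apply/funext => p; rewrite gradZ// scalerBr.
by apply: measurable_vfieldB => //; exact: measurable_grad.
Qed.

Lemma W1nZ a u X : W1n mu u X -> W1n mu (fun p => a * u p) (fun p => a *: X p).
Proof.
move=> [mu_u mX [phi [hphi cphi]]]; split.
- exact: measurable_funM.
- exact: measurable_vfieldZ.
exists (fun k p => a * phi k p); split.
  move=> k; have [sk fk gk] := hphi k; split.
  - exact: smoothZ.
  - by rewrite norm_nZ ?lte_mul_pinfty//; exact: smooth_measurable.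
  - by rewrite gradZ// norm_vnormZ ?lte_mul_pinfty//; exact: measurable_grad.
by apply: sobolev_cvgZ => // k; have [] := hphi k.
Qed.

Lemma W1n0Z a Omega u X : W1n0 mu Omega u X ->
  W1n0 mu Omega (fun p => a * u p) (fun p => a *: X p).
Proof.
move=> [wu [phi [tphi cphi]]]; split; first exact: W1nZ.
exists (fun k p => a * phi k p); split; first by move=> k; exact: test_functionZ.
by have [mu_u mX _] := wu; apply: sobolev_cvgZ => // k; have [] := tphi k.
Qed.

(** The approximating functions have finite norm, and the distance to one of
them is finite. *)
Lemma W1n_norm_lty u X : W1n mu u X -> (norm_n mu u < +oo)%E.
Proof.
move=> [mu_u mX [phi [hphi [c1 _]]]].
have [k _ /(_ _ (leqnn k)) hk] := cvge0_near_le c1 ltr01.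
have [sk fk _] := hphi k.
have mk : measurable_fun setT (phi k : borel -> R) by exact: smooth_measurable.
apply: (@le_lt_trans _ _ (norm_n mu (fun p => (-1 * (phi k p - u p))%R) + norm_n mu (phi k))%E).
  rewrite -[X in (norm_n mu X <= _)%E](_ : (fun p => (-1 * (phi k p - u p) + phi k p)%R) = u).
    by apply: LnormD => //; apply: measurable_funM => //; exact: measurable_funB.
  by apply/funext => p; rewrite mulN1r opprB addrNK.
rewrite lte_add_pinfty// norm_nZ//; last exact: measurable_funB.
by rewrite lte_mul_pinfty//; apply: le_lt_trans hk _; rewrite ltry.
Qed.

(** The approximating test functions vanish outside [Omega], so that the integral
is bounded by the distance to each of them. *)
Lemma W1n0_ae0 Omega u X : open Omega -> W1n0 mu Omega u X ->
  (\int[mu]_(p in (~` Omega : set borel)) (`|u p| ^+ n)%:E = 0)%E.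
Proof.
move=> oO [[mu_u mX _] [phi [tphi [c1 _]]]].
have mO : measurable (~` Omega : set borel).
  by apply: measurableC; exact: open_measurable_borel.
apply/eqP; rewrite eq_le; apply/andP; split; last first.
  by apply: integral_ge0 => p _; rewrite lee_fin exprn_ge0.
apply/lee_addgt0Pr => e e0; rewrite add0e.
have e10 : 0 < Num.min e 1 by rewrite lt_min e0 ltr01.
have [k _ /(_ _ (leqnn k)) hk] := cvge0_near_le c1 e10.
have [sk ck kO] := tphi k.
have mk : measurable_fun setT (fun p : borel => phi k p - u p).
  by apply: measurable_funB => //; exact: smooth_measurable.
move/(Lnorm_le_npow mu n0 _ (ltW e10)) : hk => hk.
apply: (@le_trans _ _ ((Num.min e 1) ^+ n)%:E); last first.
  rewrite lee_fin; case: n n0 => // m _; rewrite exprS.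
  apply: (@le_trans _ _ (Num.min e 1)); last by rewrite ge_min lexx.
  by rewrite ler_piMr ?exprn_ile1 ?(ltW e10)// ge_min lexx orbT.
apply: le_trans hk.
apply: (@le_trans _ _ (\int[mu]_(p in (~` Omega : set borel)) (`|phi k p - u p| ^+ n)%:E)%E).
  rewrite (eq_integral (fun p : borel => (`|phi k p - u p| ^+ n)%:E))//.
  move=> p; rewrite inE => /= pO; suff -> : phi k p = 0 by rewrite sub0r normrN.
  apply/eqP/negPn/negP => kp; apply: pO; apply: kO.
  exact: subset_closure.
by apply: ge0_subset_integral => //; exact: measurable_npow.
Qed.

End sobolev_lemmas.

(** * The Moser-Trudinger integrand and the choice of the level *)

Section mt_arg_lemmas.
Context {R : realType} {n : nat}.
Hypothesis n2 : (2 <= n)%N.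
Local Notation mt := (@mt_arg R n).
Local Notation q := (n%:R / n.-1%:R : R).

Let n0 : (0 < n)%N. Proof. exact: leq_trans n2. Qed.
Let nm0 : 0 < n.-1%:R :> R. Proof. by rewrite ltr0n; case: n n2 => [|[]]. Qed.
Let nR0 : 0 < n%:R :> R. Proof. by rewrite ltr0n. Qed.
Let q0 : 0 < q. Proof. exact: divr_gt0. Qed.
Let g0 : 0 < gamma_mt R n. Proof. exact: gamma_mt_gt0. Qed.

Lemma mt_arg_ge0 t : 0 <= mt t.
Proof. by rewrite /mt_arg mulr_ge0 ?powR_ge0// ltW. Qed.

Lemma mt_arg_le s t : `|s| <= `|t| -> mt s <= mt t.
Proof.
move=> st; rewrite /mt_arg ler_wpM2l ?(ltW g0)//.
by apply: ge0_ler_powR => //; rewrite ?nnegrE// ltW.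
Qed.

Lemma mt_arg_exp t : mt t ^+ n.-1 = gamma_mt R n ^+ n.-1 * `|t| ^+ n.
Proof.
rewrite /mt_arg exprMn; congr (_ * _).
rewrite -powR_mulrn ?powR_ge0// -powRrM divfK ?gt_eqF//.
by rewrite powR_mulrn.
Qed.

(** Hoelder's inequality for two terms with exponents [n] and [n / (n - 1)]: the
weights [1 - a] and [a] disappear because they add up to 1. This is how a gain
[a] in the energy of one part pays for the other part, without any loss in the
critical constant [gamma_mt]. *)
Lemma mt_arg_split a t x b : 0 <= a <= 1 -> 0 <= b ->
  `|t| <= (1 - a) `^ n%:R^-1 * `|x| + a `^ n%:R^-1 * b ->
  mt t <= mt x + mt b.
Proof.
move=> /andP[a0 a1] b0 ht; rewrite /mt_arg -mulrDr ler_wpM2l ?(ltW g0)//.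
rewrite (ger0_norm b0).
have pq : n%:R^-1 + q^-1 = 1.
  rewrite invf_div -{1}(div1r n%:R) -mulrDl nat1r.
  by rewrite prednK// divff// gt_eqF.
have H := hoelder2 (powR_ge0 (1 - a) n%:R^-1) (powR_ge0 a n%:R^-1) (normr_ge0 x) b0 nR0 q0 pq.
have {}H := le_trans ht H.
rewrite -!powRrM !mulVf ?gt_eqF// !powRr1 ?subr_ge0// subrK powR1 mul1r in H.
have X0 : 0 <= `|x| `^ q + b `^ q by rewrite addr_ge0// powR_ge0.
have -> : `|x| `^ q + b `^ q = ((`|x| `^ q + b `^ q) `^ q^-1) `^ q.
  by rewrite -powRrM mulVf ?gt_eqF// powRr1.
by apply: ge0_ler_powR => //; rewrite ?nnegrE ?powR_ge0// ltW.
Qed.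

Lemma continuous_norm_powR (r : R) : 0 < r -> continuous (fun t : R => `|t| `^ r).
Proof.
move=> r0 t; have [->|t0] := eqVneq t 0.
  apply/cvgrPdist_le => e e0; near=> s.
  rewrite normr0 powR0 ?gt_eqF// sub0r normrN ger0_norm ?powR_ge0//.
  rewrite -(powRr1 (ltW e0)) -(mulVf (negbT (gt_eqF r0))) powRrM.
  apply: ge0_ler_powR; rewrite ?nnegrE ?powR_ge0 ?(ltW r0)//.
  near: s; have := @nbhs0_le _ R^o (e `^ r^-1); apply.
  exact: powR_gt0.
apply: (@continuous_comp R R R (fun s : R => `|s|) (fun s : R => s `^ r)).
  exact: norm_continuous.
apply: differentiable_continuous; apply/derivable1_diffP.
by apply: derivable_powR; rewrite in_itv/= andbT normr_gt0.
Unshelve. all: by end_near. Qed.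

Lemma continuous_mt_arg : continuous mt.
Proof.
by move=> t; apply: cvgM; [exact: cvg_cst|exact: continuous_norm_powR].
Qed.

(** The integrand of the Moser-Trudinger inequality on [Omega], as a function of
the value of [u]. *)
Definition mt_integrand (t : R) : R := exp_trunc (n - 2) (mt t).

Lemma mt_integrand_ge0 t : 0 <= mt_integrand t.
Proof.
apply: le_trans (exp_trunc_ge _ (mt_arg_ge0 t)).
by rewrite divr_ge0 ?exprn_ge0 ?mt_arg_ge0.
Qed.

Lemma continuous_mt_integrand : continuous mt_integrand.
Proof.
move=> t; apply: (@continuous_comp _ _ _ mt (exp_trunc (n - 2))).
  exact: continuous_mt_arg.
exact: continuous_exp_trunc.
Qed.

Let nE : (n - 2).+1 = n.-1. Proof. by rewrite subn2 prednK//; case: n n2 => [|[]]. Qed.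

Lemma mt_integrand_ge t :
  gamma_mt R n ^+ n.-1 / n.-1`!%:R * `|t| ^+ n <= mt_integrand t.
Proof.
apply: le_trans (exp_trunc_ge _ (mt_arg_ge0 t)).
by rewrite nE mt_arg_exp mulrAC.
Qed.

Lemma mt_integrand_le s t : `|t| <= `|s| ->
  mt_integrand t <= gamma_mt R n ^+ n.-1 * expR (mt s) * `|t| ^+ n.
Proof.
move=> ts; apply: le_trans (exp_trunc_le _ (mt_arg_ge0 t)) _.
rewrite nE mt_arg_exp mulrAC ler_wpM2r ?exprn_ge0//.
by rewrite ler_wpM2l ?exprn_ge0 ?(ltW g0)// ler_expR mt_arg_le.
Qed.

Lemma mt_integrand_le_expR t : mt_integrand t <= expR (mt t).
Proof. exact: exp_trunc_le_expR (mt_arg_ge0 t). Qed.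

End mt_arg_lemmas.

Section level_selection.
Context d (T : measurableType d) (R : realType) (mu : {measure set T -> \bar R}).
Variable f : T -> R.
Hypothesis mf : measurable_fun setT f.

Lemma measurable_superlevel (s : R) : measurable [set x | s < `|f x|].
Proof.
rewrite (_ : [set x | _] = (fun x => `|f x|) @^-1` `]s, +oo[).
  rewrite -[X in measurable X]setTI.
  have mf' : measurable_fun setT (fun x => `|f x|) by exact: measurableT_comp.
  exact: mf'.
by apply/seteqP; split => x /=; rewrite in_itv/= andbT.
Qed.

(** The measure of the superlevel sets crosses the value [tau] between two
consecutive levels of the sequence [s0 / 2 ^+ k], unless it never exceeds
[tau]. *)
Lemma superlevel_selection (tau s0 : R) : 0 < s0 ->
  (mu [set x | (s0 < `|f x|)%R] <= tau%:E)%E ->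
  (mu [set x | (0 < `|f x|)%R] <= tau%:E)%E \/
  exists s, [/\ 0 < s <= s0, (mu [set x | (s < `|f x|)%R] <= tau%:E)%E &
                (tau%:E < mu [set x | (s / 2 < `|f x|)%R])%E].
Proof.
move=> s00 hs0; pose F k := [set x | s0 / 2 ^+ k < `|f x|].
have [hall|/existsNP hex] := pselect (forall k, (mu (F k) <= tau%:E)%E); [left|right].
  have FE : \bigcup_k F k = [set x | 0 < `|f x|].
    apply/seteqP; split => x /=.
      by move=> [k _]; apply: le_lt_trans; rewrite divr_ge0 ?exprn_ge0// ltW.
    move=> fx0; have [k hk] : exists k : nat, s0 / `|f x| < k%:R.
      by exists (Num.truncn (s0 / `|f x|)).+1; exact: truncnS_gt.
    exists k => //=; rewrite /F /= ltr_pdivrMr ?exprn_gt0// mulrC -ltr_pdivrMr//.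
    by rewrite (lt_trans hk)// -natrX ltr_nat ltn_expl.
  rewrite -FE.
  have : mu (F k) @[k --> \oo] --> mu (\bigcup_k F k).
    apply: nondecreasing_cvg_mu.
    - by move=> k; exact: measurable_superlevel.
    - by apply: bigcupT_measurable => k; exact: measurable_superlevel.
    - move=> k m km; apply/subsetPset => x; rewrite /F /=; apply: le_lt_trans.
      by rewrite ler_wpM2l ?(ltW s00)// lef_pV2 ?posrE ?exprn_gt0// ler_weXn2l// ler1n.
  by move/cvge_to_le; apply; apply: nearW => k; exact: hall.
have hex' : exists k, ~~ (mu (F k) <= tau%:E)%E.
  by have [k /negP hk] := hex; exists k.
case: (ex_minnP hex') => -[|k]; rewrite -ltNge /F ?expr0 ?divr1.
  by move=> /(le_lt_trans hs0); rewrite ltxx.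
move=> hk hmin; exists (s0 / 2 ^+ k); split.
- rewrite divr_gt0 ?exprn_gt0//= ler_pdivrMr ?exprn_gt0// ler_peMr ?(ltW s00)//.
  by rewrite exprn_ege1// ler1n.
- by rewrite leNgt; apply/negP => h; have := hmin k; rewrite -ltNge h ltnn => /(_ isT).
- by rewrite -mulrA -invfM -exprSr.
Qed.

End level_selection.

(** * From the Poincare inequality to test functions *)

Section from_poincare.
Context {R : realType} {n : nat} (M : riemannianManifold R n).
Local Notation borel := (borel M).
Variable mu : {measure set borel -> \bar R}.
Hypothesis n2 : (2 <= n)%N.
Variable Omega : set M.
Hypothesis oOmega : open Omega.
Implicit Types (phi u v : M -> R) (X : vfield M).
Local Notation mt := (@mt_arg R n).
Local Notation F := (@mt_integrand R n).
Local Notation I f := (npow mu n f).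

Let n0 : (0 < n)%N. Proof. exact: leq_trans n2. Qed.
Let nR0 : 0 < n%:R :> R. Proof. by rewrite ltr0n. Qed.
Let g0 : 0 < gamma_mt R n. Proof. exact: gamma_mt_gt0. Qed.

Lemma measurable_mt_integrand u : measurable_fun setT (u : borel -> R) ->
  measurable_fun setT (fun p : borel => (F (u p))%:E).
Proof.
move=> mu_u; apply/measurable_EFinP.
apply: (@measurableT_comp _ _ _ _ _ _ F) mu_u.
by apply: continuous_measurable_fun; exact: continuous_mt_integrand.
Qed.

Lemma measurable_exp_mt u : measurable_fun setT (u : borel -> R) ->
  measurable_fun setT (fun p : borel => (expR (mt (u p)))%:E).
Proof.
move=> mu_u; apply/measurable_EFinP.
apply: (@measurableT_comp _ _ _ _ _ _ (@expR R)) => //.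
apply: (@measurableT_comp _ _ _ _ _ _ mt) mu_u.
by apply: continuous_measurable_fun; exact: continuous_mt_arg.
Qed.

(** The contributions of the region where the function is at most [s], and of the
region where the local inequality is applied with an additional term [b]; [c]
bounds the integral of the [n]-th power and [C0] the local integral. *)
Definition mt_bound (s b c C0 : R) : R :=
  gamma_mt R n ^+ n.-1 * expR (mt s) * c + expR (mt b) * C0.

Lemma mt_integral_split (E : set borel) phi v (s b c C0 : R) : measurable E ->
  measurable_fun setT (phi : borel -> R) -> measurable_fun setT (v : borel -> R) ->
  (I phi <= c%:E)%E ->
  (forall p, ~ E p -> `|phi p| <= `|s|) ->
  (forall p, E p -> mt (phi p) <= mt (v p) + mt b) ->
  (\int[mu]_(p in E) (expR (mt (v p)))%:E <= C0%:E)%E ->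
  (\int[mu]_(p in (Omega : set borel)) (F (phi p))%:E <= (mt_bound s b c C0)%:E)%E.
Proof.
move=> mE mphi mv Ic lo hi hE.
have mF := measurable_mt_integrand mphi.
have F0 p : (0 <= (F (phi p))%:E)%E by rewrite lee_fin mt_integrand_ge0.
apply: (@le_trans _ _ (\int[mu]_p (F (phi p))%:E)%E).
  by apply: ge0_subset_integral => //; exact: open_measurable_borel.
rewrite -(setUv E) ge0_integral_setU//; last 3 first.
- exact: measurableC.
- by rewrite setUv.
- by rewrite disj_set2E setICr.
rewrite /mt_bound EFinD addeC; apply: leeD; last first.
  apply: (@le_trans _ _ (\int[mu]_(p in E) ((expR (mt b))%:E * (expR (mt (v p)))%:E))%E).
    apply: ge0_le_integral => //.
    - exact: measurable_funTS.
    - by apply: measurable_funTS; apply: emeasurable_funM => //; exact: measurable_exp_mt.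
    - move=> p Ep; rewrite -EFinM lee_fin -expRD.
      apply: le_trans (mt_integrand_le_expR n2 _) _.
      by rewrite ler_expR addrC; exact: hi.
  rewrite ge0_integralZl//.
  - by rewrite EFinM lee_wpmul2l// lee_fin expR_ge0.
  - by apply: measurable_funTS; exact: measurable_exp_mt.
set A := _ * expR _.
have A0 : 0 <= A by rewrite mulr_ge0 ?expR_ge0 ?exprn_ge0 ?(ltW g0).
have mA : measurable_fun setT (fun p : borel => (A%:E * (`|phi p| ^+ n)%:E)%E).
  by apply: emeasurable_funM => //; exact: measurable_npow.
apply: (@le_trans _ _ (\int[mu]_(p in ~` E) (A%:E * (`|phi p| ^+ n)%:E))%E).
  apply: ge0_le_integral => //.
  - exact: measurableC.
  - exact: measurable_funTS.
  - exact: measurable_funTS.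
  - by move=> p Ep; rewrite -EFinM lee_fin; apply: mt_integrand_le => //; exact: lo.
apply: (@le_trans _ _ (\int[mu]_p (A%:E * (`|phi p| ^+ n)%:E))%E).
  apply: ge0_subset_integral => //; first exact: measurableC.
  by move=> p _; rewrite -EFinM lee_fin mulr_ge0 ?exprn_ge0.
rewrite ge0_integralZl//; last exact: measurable_npow.
by rewrite (EFinM A) lee_wpmul2l// lee_fin.
Qed.

Lemma expr_add_compl_le1 (e : R) : 0 <= e <= 1 -> e ^+ n + (1 - e) ^+ n <= 1.
Proof.
move=> /andP[e0 e1].
have h (x : R) : 0 <= x <= 1 -> x ^+ n <= x.
  move=> /andP[x0 x1]; case: n n0 => // m _.
  by rewrite exprS ler_piMr// exprn_ile1.
have h1 : e ^+ n <= e by rewrite h ?e0.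
have h2 : (1 - e) ^+ n <= 1 - e by rewrite h// subr_ge0 e1 gerBl.
by lra.
Qed.

(** The gradients of the two parts are [e *: grad phi] and
[(1 - e) *: grad phi] with [0 <= e <= 1], and [e ^+ n + (1 - e) ^+ n <= 1]. *)
Lemma test_function_truncation phi s : 0 < s -> test_function Omega phi ->
  let v := excess_tower s 0 \o phi in let w := capped_tower s 0 \o phi in
  [/\ test_function Omega v, test_function Omega w,
      forall p, `|v p| <= `|phi p|, forall p, `|w p| <= `|2 * phi p| &
      (I (vnorm (grad v)) + I (vnorm (grad w)) <= I (vnorm (grad phi)))%E].
Proof.
move=> s0 tphi v w; have [sphi _ _] := tphi.
have tv : test_function Omega v.
  apply: (test_function_tower (derivative_tower_excess s)) => //.
  by rewrite excess_eq0// normr0 ltW.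
have tw : test_function Omega w.
  by apply: (test_function_tower (derivative_tower_capped s)) => //; exact: capped_tower0.
have [sv _ _] := tv; have [sw _ _] := tw.
split => //.
- by move=> p; exact: excess_le.
- move=> p; rewrite /w /capped_tower /= normrM (ger0_norm (ler0n _ 2)).
  rewrite (le_trans (ler_normB _ _))// mulr_natl mulr2n lerD2l.
  exact: excess_le.
have mvn u : smooth u -> measurable_fun setT (vnorm (grad u) : borel -> R).
  by move=> su; apply: measurable_vnorm; exact: measurable_grad.
rewrite /npow -ge0_integralD//; last 2 first.
- exact: measurable_npow (mvn _ sv).
- exact: measurable_npow (mvn _ sw).
apply: ge0_le_integral => //.
- by move=> p _; rewrite adde_ge0// lee_fin exprn_ge0.
- by apply: emeasurable_funD; [exact: measurable_npow (mvn _ sv)|exact: measurable_npow (mvn _ sw)].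
- exact: measurable_npow (mvn _ sphi).
move=> p _; rewrite -EFinD lee_fin.
rewrite (grad_tower (derivative_tower_excess s) sphi) (grad_tower (derivative_tower_capped s) sphi).
rewrite !(vnormZ (fun q => _ (phi q))).
rewrite capped_tower1; have := excess_derive_01 (phi p) s0.
move: (excess_tower s 1 (phi p)) => e /andP[e0 e1].
rewrite !normrM !normr_id (ger0_norm e0) (@ger0_norm _ (1 - e)) ?subr_ge0//.
rewrite !exprMn -mulrDl ler_piMl ?exprn_ge0//.
by apply: expr_add_compl_le1; rewrite e0.
Qed.

Section constants.
Variables tau C0 C : R.
Hypotheses (tau0 : 0 < tau) (C_gt0 : 0 < C).
Hypothesis LMT : forall E : set borel, measurable E -> rbounded E -> (mu E <= tau%:E)%E ->
    forall u X, W1n mu u X -> (norm_n mu (vnorm X) <= 1)%E ->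
      {ae mu, forall p, ~ E p -> u p = 0} ->
      (\int[mu]_(p in E) (expR (mt (u p)))%:E <= C0%:E)%E.
Hypothesis poinc : forall u X, W1n0 mu Omega u X ->
      (norm_n mu u <= C%:E * norm_n mu (vnorm X))%E.

Lemma poincare_npow u X c : 0 <= c -> W1n0 mu Omega u X ->
  (I (vnorm X) <= c%:E)%E -> (I u <= (C ^+ n * c)%:E)%E.
Proof.
move=> c0 wu hX.
have cE : c = (c `^ n%:R^-1) ^+ n.
  by rewrite -powR_mulrn ?powR_ge0// -powRrM mulVf ?gt_eqF// powRr1.
rewrite cE -exprMn; apply/(Lnorm_le_npow mu n0).
  by rewrite mulr_ge0 ?powR_ge0// ltW.
apply: (le_trans (poinc wu)); rewrite EFinM lee_wpmul2l ?lee_fin ?(ltW C_gt0)//.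
by apply/(Lnorm_le_npow mu n0); rewrite ?powR_ge0// -cE.
Qed.

(** By Chebyshev's inequality, a function whose [n]-th power has integral at most
[C ^+ n] exceeds this level on a set of measure at most [tau]. *)
Definition level_bound : R := 1 + C ^+ n / tau.

(** The [n]-th root of [(2 * s) ^+ n / a], where [2 * s] bounds the difference
between [`|phi|] and its excess over [s], and [2 * a = (s / 2) ^+ n * tau / C ^+ n]
is the energy that the capped part must have. The level [s] cancels. *)
Definition gap_bound : R := (2 * 4 ^+ n * C ^+ n / tau) `^ n%:R^-1.

(** The level is chosen so that the superlevel set at height [s] has measure at most
[tau] while that at height [s / 2] has more. The capped part is then large on a
set of measure more than [tau], and the Poincare inequality forces its gradient to carry
a definite amount of energy, which is missing in the gradient of the excess.
After renormalization the excess is admissible in the local inequality. *)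
Lemma test_function_moser_trudinger phi : test_function Omega phi ->
  (norm_n mu phi < +oo)%E -> (norm_n mu (vnorm (grad phi)) <= 1)%E ->
  (\int[mu]_(p in (Omega : set borel)) (F (phi p))%:E <=
   (mt_bound level_bound gap_bound (C ^+ n) C0)%:E)%E.
Proof.
move=> tphi fphi gphi; have [sphi cphi _] := tphi.
have mphi := smooth_measurable sphi.
have Cn0 : 0 < C ^+ n by rewrite exprn_gt0.
have wphi : W1n0 mu Omega phi (grad phi).
  by apply: W1n0_test_function => //; apply: le_lt_trans gphi _; rewrite ltry.
have Igphi : (I (vnorm (grad phi)) <= 1%:E)%E.
  by have /(Lnorm_le_npow mu n0 _ ler01) := gphi; rewrite expr1n.
have Iphi : (I phi <= (C ^+ n)%:E)%E.
  by have := poincare_npow ler01 wphi Igphi; rewrite mulr1.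
have bddE (s : R) : 0 <= s -> rbounded [set p | s < `|phi p|].
  move=> s0; apply: rbounded_subset (compact_rbounded cphi).
  move=> p /= sp; apply: subset_closure => /=.
  by rewrite -normr_gt0 (le_lt_trans s0).
have l0 : 0 < level_bound by rewrite ltr_pwDl// ltW// divr_gt0.
have b0 : 0 <= gap_bound by exact: powR_ge0.
have meas (s : R) : measurable ([set p | s < `|phi p|] : set borel).
  exact: measurable_superlevel.
(* [level_bound] is at least 1, hence at most its [n]-th power. *)
have start : (mu ([set p | (level_bound < `|phi p|)%R] : set borel) <= tau%:E)%E.
  have cheb := npow_chebyshev mu n mphi (ltW l0).
  have {cheb}cheb := le_trans cheb Iphi.
  have lC : C ^+ n <= level_bound ^+ n * tau.
    rewrite -ler_pdivrMr// (@le_trans _ _ level_bound)// ?lerDr//.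
    by rewrite /level_bound -[leLHS]expr1 ler_weXn2l// lerDl ltW// divr_gt0.
  have := le_trans cheb (_ : _ <= (level_bound ^+ n * tau)%:E)%E.
  rewrite lee_fin EFinM lee_pmul2l ?lte_fin ?exprn_gt0// => /(_ lC).
  apply: le_trans; apply: le_measure; rewrite ?inE//.
    exact: measurable_norm_ge.
  by move=> p /= /ltW.
have [small|[s [/andP[s0 sl] Es tauE]]] := superlevel_selection mphi l0 start.
  apply: (@mt_integral_split [set p | 0 < `|phi p|] phi phi) => //.
  - move=> p /= /negP; rewrite -leNgt => p0.
    by rewrite (le_trans p0).
  - by move=> p _; rewrite lerDl mt_arg_ge0.
  - apply: (LMT (meas 0) (bddE _ (lexx 0)) small wphi.1 gphi).
    by apply: aeW => p /= /negP; rewrite normr_gt0 negbK => /eqP.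
have [tv tw vphi wphi2 Isum] := test_function_truncation s0 tphi.
set v := excess_tower s 0 \o phi in tv vphi Isum *.
set w := capped_tower s 0 \o phi in tw wphi2 Isum *.
have [sv _ _] := tv; have [sw _ _] := tw.
have mv := smooth_measurable sv; have mw := smooth_measurable sw.
have mgv : measurable_fun setT (vnorm (grad v) : borel -> R).
  by apply: measurable_vnorm; exact: measurable_grad.
have fv : (norm_n mu v < +oo)%E by apply: le_lt_trans (Lnorm_le _ n0 mv mphi vphi) fphi.
have fw : (norm_n mu w < +oo)%E.
  have m2 : measurable_fun setT (fun p : borel => 2 * phi p) by exact: measurable_funM.
  apply: (le_lt_trans (Lnorm_le mu n0 mw m2 wphi2)).
  by rewrite -/(norm_n mu (fun p => 2 * phi p)) norm_nZ// lte_mul_pinfty.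
have Iv1 : (I (vnorm (grad v)) <= 1%:E)%E.
  by apply: le_trans Igphi; apply: le_trans Isum; rewrite leeDl// npow_ge0.
have Iw1 : (I (vnorm (grad w)) <= 1%:E)%E.
  by apply: le_trans Igphi; apply: le_trans Isum; rewrite leeDr// npow_ge0.
have Ilty u : (I (vnorm (grad u)) <= 1%:E)%E -> (norm_n mu (vnorm (grad u)) <= 1)%E.
  by move=> h; apply/(Lnorm_le_npow mu n0 _ ler01); rewrite expr1n.
have lty1 (x : \bar R) : (x <= 1)%E -> (x < +oo)%E.
  by move=> h; apply: le_lt_trans h _; rewrite ltry.
have wv := W1n0_test_function n0 tv fv (lty1 _ (Ilty _ Iv1)).
have ww := W1n0_test_function n0 tw fw (lty1 _ (Ilty _ Iw1)).
pose iv := fine (I (vnorm (grad v))); pose iw := fine (I (vnorm (grad w))).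
have ivE : I (vnorm (grad v)) = iv%:E.
  by rewrite fineK// ge0_fin_numE ?npow_ge0//; exact: lty1 Iv1.
have iwE : I (vnorm (grad w)) = iw%:E.
  by rewrite fineK// ge0_fin_numE ?npow_ge0//; exact: lty1 Iw1.
have iv0 : 0 <= iv by apply: fine_ge0; exact: npow_ge0.
have iw0 : 0 <= iw by apply: fine_ge0; exact: npow_ge0.
clearbody iv iw.
have ivw : iv + iw <= 1.
  by have := le_trans Isum Igphi; rewrite ivE iwE -EFinD lee_fin.
(* Halving the energy lost by [v] keeps [1 - a] away from zero. *)
pose a := (s / 2) ^+ n * tau / C ^+ n / 2.
have a0 : 0 < a by rewrite /a !(divr_gt0, mulr_gt0, exprn_gt0).
have a_iw : 2 * a <= iw.
  have := poincare_npow iw0 ww; rewrite iwE lexx => /(_ isT) hw.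
  have s20 : 0 < s / 2 by rewrite divr_gt0.
  have cheb := le_trans (npow_chebyshev mu n mw (ltW s20)) hw.
  have tauw : (tau%:E <= mu ([set p | (s / 2 <= `|w p|)%R] : set borel))%E.
    apply: (le_trans (ltW tauE)); apply: le_measure; rewrite ?inE//.
      exact: measurable_norm_ge.
    by move=> p /= sp; exact: capped_ge.
  have : ((s / 2) ^+ n * tau <= C ^+ n * iw).
    rewrite -lee_fin; apply: le_trans cheb; rewrite EFinM.
    by rewrite lee_wpmul2l// lee_fin exprn_ge0// ltW.
  rewrite (mulrC (C ^+ n)) -ler_pdivrMr// => /(le_trans _); apply.
  by rewrite /a mulrC divfK.
have iva : iv <= 1 - a by lra.
have a1 : a <= 1 by lra.
have la : 0 < 1 - a by lra.
pose lam := (1 - a) `^ n%:R^-1.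
have lam0 : 0 < lam by rewrite powR_gt0.
have lamn : lam ^+ n = 1 - a.
  by rewrite -powR_mulrn ?powR_ge0// -powRrM mulVf ?gt_eqF// powRr1// ltW.
have WV := W1nZ n0 lam^-1 wv.1.
apply: (@mt_integral_split [set p | s < `|phi p|] phi (fun p => lam^-1 * v p)) => //.
- exact: measurable_funM.
- move=> p /= /negP; rewrite -leNgt => ps.
  by rewrite (le_trans ps)// (le_trans sl)// ler_norm.
(* Here [a `^ n%:R^-1 * gap_bound = 2 * s]. *)
- move=> p _; apply: (@mt_arg_split _ _ n2 a) => //; first by rewrite (ltW a0).
  rewrite normrM normfV (gtr0_norm lam0) -/lam mulrA divff ?gt_eqF// mul1r.
  apply: le_trans (excess_ge (phi p) s0) _; rewrite lerD2l.
  rewrite /gap_bound -powRM ?(ltW a0)//; last first.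
    by rewrite divr_ge0 ?(ltW tau0)// mulr_ge0// ?mulr_ge0// ltW.
  rewrite (_ : a * _ = (2 * s) ^+ n).
    by rewrite -powR_mulrn ?mulr_ge0 ?(ltW s0)// -powRrM mulfV ?gt_eqF// powRr1// mulr_ge0 ?(ltW s0).
  rewrite /a expr_div_n.
  have e4 : 4 ^+ n = 2 ^+ n * 2 ^+ n :> R by rewrite -exprMn -natrM.
  rewrite e4 exprMn; field.
  by rewrite !gt_eqF//= exprn_gt0.
apply: (LMT (meas s) (bddE _ (ltW s0)) Es WV).
  rewrite norm_vnormZ//; last exact: measurable_grad.
  rewrite normfV (gtr0_norm lam0) muleC lee_pdivrMr// mul1e.
  by apply/(Lnorm_le_npow mu n0 _ (ltW lam0)); rewrite lamn ivE lee_fin.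
apply: aeW => p /= /negP; rewrite -leNgt => ps.
by rewrite /v /= excess_eq0// mulr0.
Qed.

End constants.

End from_poincare.

(** * The equivalence *)

Section both_directions.
Context {R : realType} {n : nat} (M : riemannianManifold R n).
Local Notation borel := (borel M).
Variable mu : {measure set borel -> \bar R}.
Hypothesis n2 : (2 <= n)%N.
Variable Omega : set M.
Hypothesis oOmega : open Omega.
Implicit Types (phi u v : M -> R) (X : vfield M).
Local Notation mt := (@mt_arg R n).
Local Notation F := (@mt_integrand R n).

Let n0 : (0 < n)%N. Proof. exact: leq_trans n2. Qed.
Let nR0 : 0 < n%:R :> R. Proof. by rewrite ltr0n. Qed.
Let g0 : 0 < gamma_mt R n. Proof. exact: gamma_mt_gt0. Qed.
Let mOmega : measurable (Omega : set borel).
Proof. exact: open_measurable_borel. Qed.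

Let rate (j : nat) : R := 1 / (2 ^ j.+1)%:R.

Let rate_gt0 j : 0 < rate j.
Proof. by rewrite divr_gt0// ltr0n expn_gt0. Qed.

Let cvg_rate : rate j @[j --> \oo] --> 0.
Proof.
apply: (squeeze_cvgr _ (cvg_cst 0) (@cvg_harmonic R)).
near=> j; rewrite ltW//= /rate /harmonic div1r lef_pV2 ?posrE ?ltr0n ?expn_gt0//.
by rewrite ler_nat ltnW// ltn_expl.
Unshelve. all: by end_near. Qed.

(** The approximating test functions have gradients of norm at most
[1 + rate j]; dividing by this number makes them admissible and does not change
the limit. The geometric rate gives convergence almost everywhere. *)
Lemma sobolev_approximation u X : W1n0 mu Omega u X ->
  (norm_n mu (vnorm X) <= 1)%E ->
  exists psi : nat -> M -> R,
    (forall j, [/\ test_function Omega (psi j), (norm_n mu (psi j) < +oo)%E &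
      (norm_n mu (vnorm (grad (psi j))) <= 1)%E]) /\
    {ae mu, forall p, psi j p @[j --> \oo] --> u p}.
Proof.
move=> wu X1; have [[mu_u mX _] [phi [tphi [c1 c2]]]] := wu.
have fu := W1n_norm_lty n0 wu.1.
have /choice[g hg] : forall j, exists k,
    (norm_n mu (fun p => phi k p - u p)%R <= (rate j)%:E)%E /\
    (norm_n mu (vnorm (fun p => grad (phi k) p - X p)%R) <= (rate j)%:E)%E.
  move=> j.
  have [k1 _ h1] := cvge0_near_le c1 (rate_gt0 j).
  have [k2 _ h2] := cvge0_near_le c2 (rate_gt0 j).
  by exists (maxn k1 k2); split; [apply: h1|apply: h2]; rewrite /= ?leq_maxl ?leq_maxr.
have sphi j : smooth (phi (g j)) by have [] := tphi (g j).
have mphi j : measurable_fun setT (phi (g j) : borel -> R) by exact: smooth_measurable.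
have mdiff j : measurable_fun setT (fun p : borel => phi (g j) p - u p).
  exact: measurable_funB.
pose r j := (1 + rate j)^-1.
have r0 j : 0 < 1 + rate j by rewrite addr_gt0.
exists (fun j p => r j * phi (g j) p); split.
  move=> j; have [h1 h2] := hg j; split.
  - exact: test_functionZ.
  - rewrite norm_nZ// lte_mul_pinfty//.
    apply: (@le_lt_trans _ _ (norm_n mu (fun p => (phi (g j) p - u p)%R) + norm_n mu u)%E).
      have := LnormD mu n0 (mdiff j) mu_u.
      by under eq_fun do rewrite subrK.
    by rewrite lte_add_pinfty//; apply: le_lt_trans h1 _; rewrite ltry.
  - rewrite gradZ// norm_vnormZ//; last exact: measurable_grad.
    rewrite ger0_norm ?invr_ge0 ?(ltW (r0 j))// muleC lee_pdivrMr// mul1e.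
    have mdX : measurable_vfield (fun p => grad (phi (g j)) p - X p).
      by apply: measurable_vfieldB => //; exact: measurable_grad.
    apply: (@le_trans _ _ (norm_n mu (fun p => (vnorm (fun p => grad (phi (g j)) p - X p) p + vnorm X p)%R))).
      apply: (Lnorm_le mu n0).
      + by apply: measurable_vnorm; exact: measurable_grad.
      + by apply: measurable_funD; exact: measurable_vnorm.
      + move=> p; rewrite !ger0_norm ?addr_ge0 ?vnorm_ge0//.
        have := vnorm_triangle (fun p => grad (phi (g j)) p - X p) X p.
        by rewrite (_ : (fun q => _ + X q) = grad (phi (g j)))//; apply/funext => q; rewrite subrK.
    apply: (le_trans (LnormD mu n0 (measurable_vnorm mdX) (measurable_vnorm mX))).
    by rewrite addeC EFinD; exact: leeD.
have small j : (npow mu n (fun p => (phi (g j) p - u p)%R) <= (1 / (2 ^ j.+1)%:R)%:E)%E.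
  have [/(Lnorm_le_npow mu n0 _ (ltW (rate_gt0 j))) h1 _] := hg j.
  apply: le_trans h1 _; rewrite lee_fin; case: n n0 => // m _.
  rewrite exprS ler_piMr ?(ltW (rate_gt0 j))// exprn_ile1 ?(ltW (rate_gt0 j))//.
  by rewrite /rate ler_pdivrMr ?ltr0n ?expn_gt0// mul1r ler1n expn_gt0.
have := ae_cvg_npow_summable n0 mdiff small.
apply: filterS => p hp.
have c : phi (g j) p @[j --> \oo] --> u p.
  rewrite (_ : (fun j => phi (g j) p) = (fun j => (phi (g j) p - u p) + u p)).
    by rewrite -[X in _ --> X]add0r; exact: cvgD hp (cvg_cst _).
  by apply/funext => j; rewrite subrK.
have c1r : 1 + rate j @[j --> \oo] --> (1 : R).
  by rewrite -[X in _ --> X]addr0; apply: cvgD; [exact: cvg_cst|exact: cvg_rate].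
have cr : r j @[j --> \oo] --> (1 : R)^-1 by apply: cvgV => //; exact: oner_neq0.
rewrite -[u p]mul1r -[X in X * u p]invr1; exact: cvgM cr c.
Qed.

(** Fatou's lemma extends the bound from test functions. *)
Lemma moser_trudinger_of_poincare : local_moser_trudinger mu ->
  poincare mu Omega -> moser_trudinger mu Omega.
Proof.
move=> [tau [C0 [tau0 C00 LMT]]] [C C_gt0 poinc].
pose K := @mt_bound R n (@level_bound R n tau C) (@gap_bound R n tau C) (C ^+ n) C0.
exists K.
  rewrite /K /mt_bound ltr_wpDl ?mulr_gt0 ?expR_gt0//.
  by rewrite !mulr_ge0 ?expR_ge0 ?exprn_ge0 ?(ltW g0) ?(ltW C_gt0).
move=> u X wu X1; have [psi [hpsi cpsi]] := sobolev_approximation wu X1.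
have mu_u : measurable_fun setT (u : borel -> R) by have [[]] := wu.
have mpsi j : measurable_fun setT (psi j : borel -> R).
  by have [[sp _ _] _ _] := hpsi j; exact: smooth_measurable.
have bnd j : (\int[mu]_(p in (Omega : set borel)) (F (psi j p))%:E <= K%:E)%E.
  have [tp fp gp] := hpsi j.
  exact: (test_function_moser_trudinger n2 oOmega tau0 C_gt0 LMT poinc).
have mF v : measurable_fun setT (v : borel -> R) ->
    measurable_fun (Omega : set borel) (fun p : borel => (F (v p))%:E).
  by move=> mv; apply: measurable_funTS; exact: measurable_mt_integrand.
have F0 v p : (0 <= (F (v p))%:E)%E by rewrite lee_fin mt_integrand_ge0.
apply: (le_integral_ae_cvg mOmega (fun j => mF _ (mpsi j)) (mF _ mu_u)) bnd => //.
have aeF : Filter (almost_everywhere mu) by exact: ae_filter_ringOfSetsType.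
move: cpsi; apply: filterS => p cp _.
apply: cvg_EFin; first exact: nearW.
by apply: (continuous_cvg _ _ cp); exact: continuous_mt_integrand.
Qed.

(** The inequality is applied to [t^-1 * u] for every [t] above the norm of the
gradient, so that a vanishing gradient needs no separate treatment. *)
Lemma poincare_of_moser_trudinger : moser_trudinger mu Omega -> poincare mu Omega.
Proof.
move=> [K K0 mtK].
pose c := gamma_mt R n ^+ n.-1 / n.-1`!%:R.
have c0 : 0 < c by rewrite divr_gt0 ?exprn_gt0// ltr0n fact_gt0.
pose D := (K / c) `^ n%:R^-1.
have D0 : 0 < D by rewrite powR_gt0// divr_gt0.
have Dn : D ^+ n = K / c.
  by rewrite -powR_mulrn ?powR_ge0// -powRrM mulVf ?gt_eqF// powRr1// ltW// divr_gt0.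
have key u X t : W1n0 mu Omega u X -> 0 < t -> (norm_n mu (vnorm X) <= t%:E)%E ->
    (norm_n mu u <= (D * t)%:E)%E.
  move=> wu t0 Xt; have [[mu_u mX _] _] := wu.
  have := mtK _ _ (W1n0Z n0 t^-1 wu).
  rewrite norm_vnormZ// normfV (gtr0_norm t0) muleC lee_pdivrMr// mul1e => /(_ Xt) bnd.
  apply/(Lnorm_le_npow mu n0); first by rewrite mulr_ge0 ?ltW.
  have mpow : measurable_fun setT (fun p : borel => (`|u p| ^+ n)%:E).
    exact: measurable_npow.
  have -> : npow mu n u = (\int[mu]_(p in (Omega : set borel)) (`|u p| ^+ n)%:E)%E.
    rewrite /npow -(setUv (Omega : set borel)) ge0_integral_setU//; last 3 first.
    - exact: measurableC.
    - by rewrite setUv.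
    - by rewrite disj_set2E setICr.
    by rewrite (W1n0_ae0 n0 oOmega wu) adde0.
  have k0 : 0 < c / t ^+ n by rewrite divr_gt0 ?exprn_gt0.
  rewrite -(@lee_pmul2l _ (c / t ^+ n)%:E)// ?lte_fin// -EFinM.
  rewrite (_ : _ * (D * t) ^+ n = K); last first.
    by rewrite exprMn Dn; field; rewrite !gt_eqF//= exprn_gt0.
  apply: le_trans bnd; rewrite -ge0_integralZl//; last 2 first.
  - exact: measurable_funTS.
  - by rewrite lee_fin ltW.
  apply: ge0_le_integral => //.
  - by move=> p _; rewrite -EFinM lee_fin mulr_ge0 ?exprn_ge0// ltW.
  - by apply: emeasurable_funM => //; exact: measurable_funTS.
  - apply: measurable_funTS; apply: measurable_mt_integrand => //.
    exact: measurable_funM.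
  - move=> p _; rewrite -EFinM lee_fin; apply: le_trans (mt_integrand_ge n2 _).
    rewrite normrM normfV (gtr0_norm t0) (exprMn n t^-1) exprVn.
    by rewrite -/c mulrA.
exists D => // u X wu.
have [->|Xfin] := eqVneq (norm_n mu (vnorm X)) +oo%E.
  by rewrite gt0_muley ?lte_fin// leey.
have X0 : (0 <= norm_n mu (vnorm X))%E by exact: Lnorm_ge0.
have XE : norm_n mu (vnorm X) = (fine (norm_n mu (vnorm X)))%:E.
  by rewrite fineK// ge0_fin_numE// ltey.
rewrite XE; have := XE; move: (fine _) => x {}XE.
have x0 : 0 <= x by rewrite XE lee_fin in X0.
apply/lee_addgt0Pr => e e0.
have := key u X (x + e / D) wu.
rewrite mulrDr mulrCA divff ?gt_eqF// mulr1 EFinD EFinM; apply.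
  by rewrite ltr_wpDl// divr_gt0.
by rewrite XE lee_fin lerDl ltW// divr_gt0.
Qed.

End both_directions.

Theorem theorem1 (R : realType) (n : nat) (hn : (2 <= n)%N)
    (M : riemannianManifold R n) (mu : {measure set (borel M) -> \bar R})
    (hmu : riemannian_measure mu) (hM : rcomplete M)
    (hLMT : local_moser_trudinger mu)
    (Omega : set M) (hOmega : open Omega) :
  moser_trudinger mu Omega <-> poincare mu Omega.
Proof.
split; first exact: poincare_of_moser_trudinger.
exact: moser_trudinger_of_poincare.
Qed.
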